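(* Let $r\ge 5$ be an integer. Then $|C(n,r)|=\frac{n^2}{2}-\frac{n^2}{2r}+o(n^2)$ as $n\to\infty$.
   Context: For positive integers $n,r$, let $C(n,r)=\left\{\sum_{i=1}^{r}\binom{n_i}{2}:\ n_1,\dots,n_r \text{ non-negative integers with } \sum_{i=1}^{r}n_i=n\right\}$, i.e. the set of possible edge counts of an $n$-vertex graph that is a disjoint union of at most $r$ cliques. *)

(* Defs.v *)
From HB Require Import structures.
From mathcomp Require Import all_boot all_order all_algebra.
From mathcomp Require Import finmap.
From mathcomp Require Import all_classical all_reals all_analysis.

Set Implicit Arguments.
Unset Strict Implicit.
Unset Printing Implicit Defensive.

Import Order.TTheory GRing.Theory Num.Theory.

Local Open Scope classical_set_scope.

(* The possible numbers of edges of an n-vertex disjoint union of at most r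
   cliques; k i is the order of the i-th clique, 0 being allowed. *)
Definition cliqueEdgeCounts (n r : nat) : set nat :=
  [set m | exists2 k : 'I_r -> nat,
     \sum_(i < r) k i = n & m = \sum_(i < r) 'C(k i, 2)]%N.

(* fset_set below returns the empty set on an infinite argument; this lemma
   shows that it is only applied to finite sets. *)
Lemma finite_cliqueEdgeCounts (n r : nat) :
  finite_set (cliqueEdgeCounts n r).
Proof.
apply: (@sub_finite_set _ _ `I_(r * 'C(n, 2)).+1); last exact: finite_II.
move=> _ [k kn ->] /=.
rewrite ltnS -[X in (_ <= X * _)%N](card_ord r) -sum_nat_const.
apply: leq_sum => i _; apply: leq_bin2l.
by rewrite -kn (bigD1 i) //= leq_addr.
Qed.

Definition numCliqueEdgeCounts (n r : nat) : nat :=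
  #|` fset_set (cliqueEdgeCounts n r)|%fset.

(* Main.v *)
Require Import Defs.
From mathcomp Require Import all_boot all_order all_algebra.
From mathcomp Require Import perm cyclic finfield finmap.
From mathcomp Require Import all_classical all_reals all_analysis.
From mathcomp Require Import zify ring lra.

(* Writing [S = 2 m + n], the edge counts [m] correspond to the values [S] of
   [sum k_i^2] subject to [sum k_i = n]; they have the parity of [n] and lie
   between [n^2 / r] and [n^2].  Conversely every [S] of the right parity which
   is not too close to the ends of this interval is attained: fix all cliques
   but four and apply Cauchy's lemma (if [a], [b] are odd, [b^2 < 4 a] and
   [3 a <= b^2], then some four naturals have sum [b] and sum of squares [a]),
   which rests on the fact that every [N = 3] mod 8 is a sum of three squares.

   For the latter it suffices to find [P] such that [-P] is an invertible square
   mod [N] and [-N] is a square mod [P]: these data yield a unimodular positive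
   definite ternary form representing [N], which by Hermite's bound on minima is
   equivalent to [x^2 + y^2 + z^2].  Instead of a prime from Dirichlet's theorem,
   we take [P = 2 q] where [q] is the squarefree kernel of an integer
   [m = (N - 1) / 2] mod [2 N] with nonzero [f m = sum_(d | m) chi d], [chi] being
   the Jacobi symbol mod [N] restricted to odd integers.  Such an [m] exists as
   the hyperbola method compares the sum of [f] over this residue class with
   [L(1, chi)], which is positive by Monsky's argument. *)

Set Implicit Arguments.
Unset Strict Implicit.
Unset Printing Implicit Defensive.

Import Order.TTheory GRing.Theory Num.Theory.
Import numFieldNormedType.Exports.

Local Open Scope ring_scope.
Local Open Scope classical_set_scope.

(** * Unimodular positive definite forms *)

Section GramMatrix.
Variables (R : comNzRingType) (n : nat).
Implicit Types (A U : 'M[R]_n) (v : 'rV[R]_n).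

Definition qform A v : R := (v *m A *m v^T) 0 0.

Definition grammx A U : 'M[R]_n := U *m A *m U^T.

Lemma qform_gram A U v : qform (grammx A U) v = qform A (v *m U).
Proof. by rewrite /qform /grammx trmx_mul !mulmxA. Qed.

Lemma gram_diag A U i : grammx A U i i = qform A (row i U).
Proof.
rewrite /qform /grammx -row_mul !mxE; apply: eq_bigr => j _.
by rewrite [row _ _ _ _]mxE !mxE.
Qed.

Lemma gramM A U V : grammx (grammx A U) V = grammx A (V *m U).
Proof. by rewrite /grammx trmx_mul !mulmxA. Qed.

Lemma gram1 A : grammx A 1%:M = A.
Proof. by rewrite /grammx trmx1 mul1mx mulmx1. Qed.

Lemma tr_gram A U : A^T = A -> (grammx A U)^T = grammx A U.
Proof. by move=> symA; rewrite /grammx !trmx_mul trmxK symA mulmxA. Qed.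

End GramMatrix.

Section Bordered.
Variables (R : comNzRingType) (n : nat) (a : R) (u : 'cV[R]_n) (B : 'M[R]_n).

Definition bordermx : 'M[R]_(1 + n) := block_mx a%:M u^T u B.

(* The Schur complement of the corner, scaled by [a] to stay in the ring. *)
Definition schurmx : 'M[R]_n := a *: B - u *m u^T.

Lemma bordermx_corner : bordermx 0 0 = a.
Proof.
have -> : 0 = lshift n 0 :> 'I_(1 + n) by exact/val_inj.
by rewrite block_mxEul mxE eqxx.
Qed.

Lemma tr_bordermx : B^T = B -> bordermx^T = bordermx.
Proof. by move=> symB; rewrite tr_block_mx tr_scalar_mx trmxK symB. Qed.

Lemma tr_schur : B^T = B -> schurmx^T = schurmx.
Proof. by move=> symB; rewrite /schurmx linearB linearZ /= trmx_mul trmxK symB. Qed.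

Lemma qform_complete_square (k : R) (v : 'rV[R]_n) :
  a * qform bordermx (row_mx k%:M v) = (a * k + (v *m u) 0 0) ^+ 2 + qform schurmx v.
Proof.
have uvE : v *m u = ((v *m u) 0 0)%:M by rewrite -mx11_scalar.
have qBE : v *m B *m v^T = (qform B v)%:M by rewrite -mx11_scalar.
have utE : u^T *m v^T = ((v *m u) 0 0)%:M by rewrite -trmx_mul [in LHS]uvE tr_scalar_mx.
rewrite /qform /schurmx mulmxBr mulmxBl -scalemxAr -scalemxAl mulmxA.
rewrite -[v *m u *m _ *m _]mulmxA utE qBE mul_row_block tr_row_mx mul_row_col.
rewrite !mulmxDl -[k%:M *m u^T *m _]mulmxA utE qBE uvE tr_scalar_mx.
by rewrite -!scalar_mxM !mxE eqxx !mulr1n; ring.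
Qed.

Lemma det_schur : a ^+ n * \det bordermx = a * \det schurmx.
Proof.
have -> : a ^+ n = \det (block_mx 1%:M 0 (- u) a%:M : 'M[R]_(1 + n)).
  by rewrite det_lblock det1 det_scalar mul1r.
rewrite -det_mulmx mulmx_block !mul1mx !mul0mx !addr0 mul_mx_scalar mul_scalar_mx.
by rewrite scalerN addNr det_ublock det_scalar1 mul_scalar_mx addrC mulNmx.
Qed.

End Bordered.

Lemma symmetric_bordermxP (R : comNzRingType) (n : nat) (A : 'M[R]_(1 + n)) : A^T = A ->
  exists a u B, B^T = B /\ A = bordermx a u B.
Proof.
move=> symA; exists (A 0 0), (dlsubmx A), (drsubmx A); split; first by rewrite trmx_drsub symA.
rewrite /bordermx trmx_dlsub symA -[LHS]submxK [ulsubmx A]mx11_scalar; congr block_mx.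
by congr scalar_mx; rewrite !mxE; congr (A _ _); apply/val_inj.
Qed.

Definition posdefmx (R : numDomainType) (n : nat) (A : 'M[R]_n) : Prop :=
  forall v : 'rV[R]_n, v != 0 -> 0 < qform A v.

Section PositiveDefinite.
Variables (R : realDomainType) (n : nat).
Implicit Types (a : R) (u : 'cV[R]_n) (B : 'M[R]_n).

Lemma posdef_schur a u B : posdefmx (bordermx a u B) -> 0 < a /\ posdefmx (schurmx a u B).
Proof.
move=> posA; have a0 : 0 < a.
  have /posA : row_mx 1%:M 0 != 0 :> 'rV[R]_(1 + n).
    by rewrite row_mx_eq0 negb_and matrix_nonzero1.
  by rewrite /qform mul_row_block !mul1mx !mul0mx !addr0 tr_row_mx mul_row_col
    trmx1 mulmx1 trmx0 mulmx0 addr0 mxE.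
split=> // v v0; have /posA : row_mx (- (v *m u) 0 0)%:M (a *: v) != 0.
  by rewrite row_mx_eq0 negb_and scalemx_eq0 (gt_eqF a0) v0 orbT.
rewrite -(pmulr_rgt0 _ a0) qform_complete_square -scalemxAl.
rewrite [(a *: (v *m u)) 0 0]mxE mulrN addNr expr0n add0r /qform.
rewrite -!scalemxAl linearZ -scalemxAr 2!mxE.
by rewrite !(pmulr_rgt0 _ a0).
Qed.

Lemma posdef_bordermx a u B : 0 < a -> posdefmx (schurmx a u B) ->
  posdefmx (bordermx a u B).
Proof.
move=> a0 posS w; rewrite -[w]hsubmxK [lsubmx w]mx11_scalar.
move: (lsubmx w 0 0) (rsubmx w) => k v; rewrite -(pmulr_rgt0 _ a0).
rewrite qform_complete_square; have [->|v0 _] := eqVneq v 0; last first.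
  by rewrite ltr_wpDl ?sqr_ge0 // posS.
rewrite row_mx_eq0 eqxx andbT mul0mx mxE addr0 /qform !mul0mx mxE addr0.
have [->|k0 _] := eqVneq k 0; first by rewrite raddf0 eqxx.
by rewrite exprn_even_gt0 //= mulf_neq0 // gt_eqF.
Qed.

Lemma posdef_scalar a : 0 < a -> posdefmx (a%:M : 'M[R]_n).
Proof.
move=> a0 v; apply: contraNT.
rewrite /qform mul_mx_scalar -scalemxAl !mxE pmulr_rgt0 // => sum_le0.
have sqr_j j : v 0 j * v^T j 0 = v 0 j ^+ 2 by rewrite mxE expr2.
rewrite (eq_bigr _ (fun j _ => sqr_j j)) in sum_le0.
have sum0 : \sum_j v 0 j ^+ 2 == 0.
  by rewrite eq_le leNgt sum_le0 sumr_ge0 // => j _; exact: sqr_ge0.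
apply/eqP/rowP => j; apply/eqP; rewrite mxE -sqrf_eq0.
move: sum0; rewrite psumr_eq0 => [/allP/(_ j (mem_index_enum _))//|i _]; exact: sqr_ge0.
Qed.

End PositiveDefinite.

Lemma posdef_gram (R : numDomainType) (n : nat) (A U : 'M[R]_n) :
  U \in unitmx -> posdefmx A -> posdefmx (grammx A U).
Proof.
move=> unitU posA v v0; rewrite qform_gram; apply: posA.
by apply: contraNneq v0 => vU0; rewrite -(mulmxK unitU v) vU0 mul0mx.
Qed.

Lemma row_unitmx_neq0 (R : comUnitRingType) (n : nat) (U : 'M[R]_n) (i : 'I_n) :
  U \in unitmx -> row i U != 0.
Proof.
apply: contraTneq => Ui0; rewrite unitmxE (expand_det_row _ i) big1 ?unitr0 // => j _.
by have /rowP/(_ j) := Ui0; rewrite !mxE => ->; rewrite mul0r.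
Qed.

Lemma gram_diag_gt0 (R : numDomainType) (n : nat) (A U : 'M[R]_n) (i : 'I_n) :
  U \in unitmx -> posdefmx A -> 0 < grammx A U i i.
Proof. by move=> unitU posA; rewrite gram_diag; apply/posA/row_unitmx_neq0. Qed.

Lemma det_gram (n : nat) (A U : 'M[int]_n) : U \in unitmx -> \det (grammx A U) = \det A.
Proof.
by rewrite unitmxE /grammx !det_mulmx det_tr => /orP[] /eqP ->; ring.
Qed.

Definition corner_minimal (n : nat) (A : 'M[int]_n.+1) : Prop :=
  forall U, U \in unitmx -> A 0 0 <= grammx A U 0 0.

Lemma exists_corner_minimal (n : nat) (A : 'M[int]_n.+1) : posdefmx A ->
  exists2 U, U \in unitmx & corner_minimal (grammx A U).
Proof.
move=> posA; pose attained k := `[< exists2 U, U \in unitmx & grammx A U 0 0 = k%:Z >].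
have corner_attained U : U \in unitmx -> exists2 k, grammx A U 0 0 = k%:Z & attained k.
  move=> unitU; have gt0 := gram_diag_gt0 0 unitU posA.
  exists (absz (grammx A U 0 0)); first by rewrite gez0_abs // ltW.
  by apply/asboolP; exists U; rewrite ?gez0_abs // ltW.
have [k0 _ att0] := corner_attained _ (unitmx1 _ _).
have [k /asboolP[U unitU kE] kmin] := ex_minnP (ex_intro attained k0 att0).
exists U => // V unitV; rewrite gramM kE.
have [|j -> /kmin] := corner_attained (V *m U); first by rewrite unitmx_mul unitV.
by rewrite lez_nat.
Qed.

Lemma exists_centered_residue (a b : int) : 0 < a ->
  exists k : int, 4 * (a * k + b) ^+ 2 <= a ^+ 2.
Proof.
move=> a0; exists (- ((2 * b + a) %/ (2 * a))%Z).
have := divz_eq (2 * b + a) (2 * a).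
have := modz_ge0 (2 * b + a) (_ : 2 * a != 0).
have := ltz_pmod (2 * b + a) (_ : 0 < 2 * a).
set q := (_ %/ _)%Z; set r := (_ %% _)%Z => /(_ ltac:(lia)) r_lt /(_ ltac:(lia)) r_ge0 qrE.
have -> : 4 * (a * - q + b) ^+ 2 = (r - a) ^+ 2.
  by rewrite (_ : r = 2 * b + a - q * (2 * a)); [ring | rewrite qrE; ring].
rewrite -subr_ge0 (_ : _ - _ = r * (2 * a - r)); last by ring.
by rewrite mulr_ge0 // subr_ge0 ltW.
Qed.

Lemma corner_minimal_schur (n : nat) (a : int) u B (V : 'M[int]_n.+1) : 0 < a ->
  @corner_minimal n.+1 (bordermx a u B) -> V \in unitmx ->
  3 * a ^+ 2 <= 4 * grammx (schurmx a u B) V 0 0.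
Proof.
move=> a_gt0 minA unitV; rewrite gram_diag; set v := row 0 V.
have [k le_k] := exists_centered_residue ((v *m u) 0 0) a_gt0.
pose U : 'M[int]_(1 + n.+1) :=
  xrow 0 (lift 0 0) (block_mx 1%:M 0 (\col_i (if i == 0 then k else 0)) V).
have unitU : U \in unitmx.
  by rewrite /U xrowE unitmx_mul unitmx_perm unitmxE det_lblock det1 mul1r -unitmxE.
have rowU : row 0 U = row_mx k%:M v.
  apply/rowP => j; rewrite !mxE tpermL.
  case: splitP => i; first by rewrite (ord1 i).
  rewrite lift0 => -[i0]; have -> : i = 0 by exact/val_inj.
  by rewrite !mxE; case: splitP => l; rewrite !mxE ?(ord1 l).
have := minA _ unitU; rewrite bordermx_corner gram_diag rowU -(ler_pM2l a_gt0).
rewrite qform_complete_square -expr2; move: le_k.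
by move: (_ ^+ 2) (a ^+ 2) (qform _ _) => s t q; lia.
Qed.

(* Induction through the Schur complement of a form with minimal corner [a]: its
   own corners are at least [3 / 4 * a ^+ 2]. *)
Lemma hermite_inequality (n : nat) (A : 'M[int]_n.+1) : A^T = A -> posdefmx A ->
  exists2 U, U \in unitmx &
    3 ^+ 'C(n.+1, 2) * (grammx A U 0 0) ^+ n.+1 <= 4 ^+ 'C(n.+1, 2) * \det A.
Proof.
elim: n A => [|n IHn] A symA posA.
  exists 1%:M; first exact: unitmx1.
  by rewrite gram1 !mul1r expr1 det_mx11.
have [U unitU minU] := exists_corner_minimal posA; exists U => //.
rewrite -(det_gram A unitU); move: (tr_gram U symA) (posdef_gram unitU posA) minU.
move: (grammx A U) => {symA posA unitU U}A /symmetric_bordermxP[a [u [B [symB ->]]]].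
rewrite bordermx_corner => posA minA.
have [a0 posS] := posdef_schur posA.
have [V unitV IH] := IHn _ (tr_schur a u symB) posS.
have le_aq := corner_minimal_schur a0 minA unitV.
rewrite -(ler_pM2l (exprn_gt0 n.+1 a0)) [leRHS]mulrCA det_schur.
move: (grammx _ V 0 0) (\det (schurmx a u B)) IH le_aq => q d IH le_aq.
have le_pow : (3 * a ^+ 2) ^+ n.+1 <= (4 * q) ^+ n.+1.
  have q0 : 0 <= 4 * q by rewrite (le_trans _ le_aq) // mulr_ge0 ?sqr_ge0.
  by rewrite lerXn2r // nnegrE mulr_ge0 ?sqr_ge0.
have -> : 'C(n.+2, 2) = ('C(n.+1, 2) + n.+1)%N by rewrite binS bin1.
move: 'C(n.+1, 2) IH => c IH; rewrite !exprD.
have -> : a ^+ n.+1 * (3 ^+ c * 3 ^+ n.+1 * a ^+ n.+2)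
    = 3 ^+ c * (3 * a ^+ 2) ^+ n.+1 * a.
  by rewrite exprMn [a ^+ n.+2]exprS -exprM mulnC exprM expr2; ring.
have -> : 4 ^+ c * 4 ^+ n.+1 * (a * d) = 4 ^+ n.+1 * (4 ^+ c * d) * a.
  by ring.
rewrite ler_pM2r // (le_trans (ler_wpM2l _ le_pow)) ?exprn_ge0 //.
by rewrite exprMn mulrCA ler_wpM2l ?exprn_ge0.
Qed.

Lemma exists_unit_corner (n : nat) (A : 'M[int]_n.+1) : (n < 5)%N ->
  A^T = A -> posdefmx A -> \det A = 1 -> exists2 U, U \in unitmx & grammx A U 0 0 = 1.
Proof.
move=> n5 symA posA detA; have [U unitU] := hermite_inequality symA posA.
rewrite detA mulr1 => le_corner; exists U => //.
have := gram_diag_gt0 0 unitU posA; move: (grammx A U 0 0) le_corner => a le_a a0.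
apply/eqP; rewrite eq_le -gtz0_ge1 a0 andbT leNgt; apply/negP => a2.
have : 2 ^+ n.+1 <= a ^+ n.+1 by rewrite lerXn2r // nnegrE ltW.
move/(ler_wpM2l (exprn_ge0 'C(n.+1, 2) (isT : 0 <= 3 :> int)))/le_trans/(_ le_a).
rewrite bin2; case: n n5 {A symA posA detA U unitU a le_a a0 a2} => [|[|[|[|[|//]]]]] _ /=; lia.
Qed.

Theorem unimodular_sum_of_squares (n : nat) (A : 'M[int]_n) : (n <= 5)%N ->
  A^T = A -> posdefmx A -> \det A = 1 -> exists P : 'M[int]_n, A = P *m P^T.
Proof.
elim: n A => [|n IHn] A n5 symA posA detA.
  by exists 0; apply/matrixP => -[].
have [U unitU corner1] := exists_unit_corner n5 symA posA detA.
suff [P gramE] : exists P : 'M[int]_n.+1, grammx A U = P *m P^T.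
  exists (invmx U *m P); rewrite -[LHS]gram1 -(mulVmx unitU) -gramM gramE.
  by rewrite /grammx trmx_mul !mulmxA.
have := det_gram A unitU; rewrite detA.
move: (tr_gram U symA) (posdef_gram unitU posA) corner1.
move: (grammx A U) => {symA posA unitU U detA}A /symmetric_bordermxP[a [u [B [symB ->]]]].
rewrite bordermx_corner => /[swap] -> posA detA; have [_ posS] := posdef_schur posA.
have [|P SE] := IHn _ (ltnW n5) (tr_schur 1 u symB) posS.
  by have := det_schur 1 u B; rewrite detA expr1n !mul1r.
pose Q : 'M[int]_(1 + n) := block_mx 1%:M 0 u P.
suff QE : bordermx 1 u B = Q *m Q^T by exists Q.
rewrite /Q tr_block_mx mulmx_block trmx1 trmx0 !mulmx0 !mul0mx !mul1mx mulmx1 !addr0.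
by rewrite -SE /schurmx scale1r [_ + (_ - _)]addrC subrK.
Qed.

(* With [- P] a square mod [n] and [- n] a square mod [P], the integers [s] and
   [u] complete a unimodular positive definite ternary form representing [n]. *)
Lemma three_squares_of_residues (n P s t b u : int) : 0 < n -> 0 < P ->
  n * s = P * t ^+ 2 + 1 -> P * u = b ^+ 2 * s + 1 ->
  exists x y z : int, n = x ^+ 2 + y ^+ 2 + z ^+ 2.
Proof.
move=> n0 P0 nsE PuE; pose c := n * u - (t * b) ^+ 2.
have cE : P * c = n + b ^+ 2.
  transitivity (n * (P * u) - P * t ^+ 2 * b ^+ 2); first by rewrite /c; ring.
  by rewrite PuE -(addrK 1 (P * t ^+ 2)) -nsE; ring.
pose w : 'cV[int]_(1 + 1) := col_mx (P * t)%:M (t * b)%:M.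
pose B := bordermx (P * s) (b * s)%:M u%:M.
have schurE : schurmx n w B = bordermx P b%:M c%:M.
  rewrite /schurmx /B /bordermx scale_block_mx tr_col_mx !tr_scalar_mx mul_col_row.
  rewrite opp_block_mx add_block_mx -!scalar_mxM !scale_scalar_mx -!raddfB /= /c.
  by congr (block_mx _%:M _%:M _%:M _%:M); rewrite mulrCA nsE; ring.
have schur2E : schurmx P b%:M c%:M = n%:M.
  rewrite /schurmx tr_scalar_mx -scalar_mxM scale_scalar_mx -raddfB /= cE.
  by congr _%:M; ring.
have [||||Q AE] := @unimodular_sum_of_squares 3 (bordermx n w B).
- by [].
- by rewrite !tr_bordermx ?tr_scalar_mx.
- do 2!(apply: posdef_bordermx; rewrite ?schurE ?schur2E //).
  exact: posdef_scalar.
- apply: (mulfI (_ : n ^+ 2 * P != 0)); first by rewrite mulf_neq0 ?expf_neq0 ?gt_eqF.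
  have := det_schur P b%:M c%:M; rewrite schur2E det_scalar1 expr1 => detS.
  by rewrite mulr1 [LHS]mulrAC [n ^+ 2 * \det _]det_schur schurE mulrAC -mulrA detS; ring.
exists (Q 0 0), (Q 0 (lift 0 0)), (Q 0 (lift 0 (lift 0 0))).
rewrite -[LHS](bordermx_corner n w B) AE mxE !big_ord_recl big_ord0 !mxE.
by rewrite addr0 addrA -!expr2.
Qed.

(** * The Jacobi symbol *)

Definition upper_half (N x : nat) : bool := (N./2 < x %% N)%N.

Definition abs_residue (N x : nat) : nat :=
  if upper_half N x then (N - x %% N)%N else (x %% N)%N.

(* Gauss's lemma taken as a definition, for composite odd [N] as well. *)
Definition jacobi (N d : nat) : int :=
  if coprime d N then \prod_(i < N./2) (-1) ^+ upper_half N (d * i.+1) else 0.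

Section AbsResidue.
Local Open Scope nat_scope.
Variable N : nat.
Hypothesis oddN : odd N.

Lemma upper_half_opp (x y : nat) : ~~ (N %| x) -> N %| x + y ->
  upper_half N y = ~~ upper_half N x.
Proof.
rewrite /upper_half /dvdn -modnDm => x0 /eqP xy0.
have : (x %% N + y %% N) %/ N * N = x %% N + y %% N by rewrite [RHS](divn_eq _ N) xy0 addn0.
have := ltn_pmod x (odd_gt0 oddN); have := ltn_pmod y (odd_gt0 oddN).
by case: (_ %/ N) => [|[|k]]; lia.
Qed.

Lemma abs_residue_bounds (x : nat) : ~~ (N %| x) -> 0 < abs_residue N x <= N./2.
Proof.
rewrite /abs_residue /upper_half /dvdn; have := ltn_pmod x (odd_gt0 oddN).
by case: ifP; lia.
Qed.

Lemma upper_half_mul (d x : nat) : ~~ (N %| d * x) ->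
  upper_half N (d * x) = upper_half N (d * abs_residue N x) (+) upper_half N x.
Proof.
rewrite /abs_residue => dx0; case: ifP => _; last by rewrite addbF /upper_half modnMmr.
rewrite addbT (@upper_half_opp (d * x) (d * (N - x %% N))) ?negbK // -mulnDr dvdn_mull // /dvdn.
by rewrite -modnDml subnKC ?modnn // ltnW // ltn_pmod // odd_gt0.
Qed.

Section CoprimeMultiplier.
Variable d : nat.
Hypothesis cop : coprime d N.

Lemma Ndvdn_coprime_mul i : 0 < i < N -> ~~ (N %| d * i).
Proof. by move=> /andP[i0 iN]; rewrite Gauss_dvdr 1?coprime_sym // gtnNdvd. Qed.

Lemma Ndvdn_coprime_mul_half (i : 'I_N./2) : ~~ (N %| d * i.+1).
Proof. by apply: Ndvdn_coprime_mul; have := ltn_ord i; lia. Qed.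

Lemma abs_residue_inj i j : 0 < i <= N./2 -> 0 < j <= N./2 ->
  abs_residue N (d * i) = abs_residue N (d * j) -> i = j.
Proof.
wlog le_ij : i j / i <= j.
  move=> wlog_le ib jb.
  by case/orP: (leq_total i j) => ij; [|move/esym]; move/wlog_le => ->.
move=> ib jb.
have same : d * i %% N = d * j %% N -> i = j.
  move=> /eqP; rewrite eq_sym eqn_mod_dvd ?leq_mul2l ?le_ij ?orbT // -mulnBr.
  have [lt_ij|] := ltnP i j; last by lia.
  by move=> dv; have := @Ndvdn_coprime_mul (j - i); rewrite dv; lia.
have opposite : d * i %% N + d * j %% N = N -> i = j.
  move=> ijN; have := @Ndvdn_coprime_mul (i + j).
  by rewrite /dvdn mulnDr -modnDm ijN modnn; lia.
have := ltn_pmod (d * i) (odd_gt0 oddN); have := ltn_pmod (d * j) (odd_gt0 oddN).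
rewrite /abs_residue; case: ifP => _; case: ifP => _ jN iN eq_ij;
  by [apply: same; lia | apply: opposite; lia].
Qed.

Lemma big_abs_residue (R : Type) (idx : R) (op : Monoid.com_law idx) (F : nat -> R) :
  \big[op/idx]_(i < N./2) F (abs_residue N (d * i.+1)) = \big[op/idx]_(i < N./2) F i.+1.
Proof.
have boundP (i : 'I_N./2) := abs_residue_bounds (Ndvdn_coprime_mul_half i).
have sP (i : 'I_N./2) : (abs_residue N (d * i.+1)).-1 < N./2 by have := boundP i; lia.
have s_inj : injective (fun i => Ordinal (sP i)).
  move=> i j /(congr1 val) /= E; apply/val_inj/succn_inj/abs_residue_inj.
  - exact: ltn_ord.
  - exact: ltn_ord.
  - by have := boundP i; have := boundP j => /=; lia.
rewrite [RHS](reindex_inj s_inj); apply: eq_bigr => i _ /=.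
by rewrite prednK //; case/andP: (boundP i).
Qed.

End CoprimeMultiplier.
End AbsResidue.

Lemma jacobi_mod (N d : nat) : jacobi N (d %% N) = jacobi N d.
Proof.
rewrite /jacobi coprime_modl; case: ifP => // _.
by apply: eq_bigr => i _; rewrite /upper_half modnMml.
Qed.

Lemma jacobi_val (N d : nat) : [|| jacobi N d == 0, jacobi N d == 1 | jacobi N d == -1].
Proof.
rewrite /jacobi; case: ifP => // _.
by rewrite -expr_sum -signr_odd; case: (odd _).
Qed.

Lemma jacobi1 (N : nat) : odd N -> jacobi N 1 = 1.
Proof.
move=> oddN; rewrite /jacobi coprime1n big1 // => i _.
have iN := ltn_ord i; rewrite /upper_half mul1n modn_small; last by lia.
by rewrite ltnNge iN.
Qed.

Lemma jacobiM (N d e : nat) : odd N -> jacobi N (d * e) = jacobi N d * jacobi N e.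
Proof.
move=> oddN; rewrite /jacobi coprimeMl.
case: (boolP (coprime d N)) => copd /=; last by rewrite mul0r.
case: (boolP (coprime e N)) => cope; last by rewrite mulr0.
rewrite -(big_abs_residue oddN cope _ (fun j => (-1) ^+ upper_half N (d * j))).
rewrite -big_split /=; apply: eq_bigr => i _; rewrite -signr_addb -mulnA.
by rewrite upper_half_mul // mulnA Ndvdn_coprime_mul_half // coprimeMl copd.
Qed.

Lemma jacobiN (N d : nat) : (N %% 4 = 3)%N -> (d <= N)%N -> jacobi N (N - d) = - jacobi N d.
Proof.
move=> N3 dN; have oddN : odd N by lia.
have copE : coprime (N - d) N = coprime d N.
  by rewrite -{2}(subnK dN) /coprime gcdnDl gcdnC -{2}(subnK dN) gcdnDr.
rewrite /jacobi copE; case: ifP => cop; last by rewrite oppr0.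
have -> : - (\prod_(i < N./2) (-1) ^+ upper_half N (d * i.+1)) =
    \prod_(i < N./2) (-1 * (-1) ^+ upper_half N (d * i.+1)) :> int.
  by rewrite big_split prodr_const card_ord /= -signr_odd (_ : odd N./2) ?mulN1r //; lia.
apply: eq_bigr => i _; rewrite mulN1r -signrN (@upper_half_opp _ oddN (d * i.+1)) //.
  exact: Ndvdn_coprime_mul_half.
by rewrite -mulnDl subnKC // dvdn_mulr.
Qed.

Lemma jacobi2 (N : nat) : (N %% 8 = 3)%N -> jacobi N 2 = -1.
Proof.
move=> N3; have oddN : odd N by lia.
rewrite /jacobi coprime2n oddN; pose k := (N %/ 8 * 2)%N.
have signE i : (i < N./2)%N -> upper_half N (2 * i.+1) = (k <= i)%N.
  by move=> iN; rewrite /upper_half modn_small /k; lia.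
rewrite (eq_bigr (fun i : 'I_N./2 => (-1) ^+ (k <= i)%N)) => [|i _]; last by rewrite signE.
have -> : N./2 = (k + k.+1)%N by rewrite /k; lia.
rewrite big_split_ord /= big1 => [|i _]; last by rewrite leqNgt ltn_ord.
rewrite (eq_bigr (fun=> -1)) => [|i _]; last by rewrite leq_addr.
by rewrite mul1r prodr_const card_ord -signr_odd (_ : odd k.+1 = true) // /k; lia.
Qed.

Lemma jacobi_eisenstein (N d : nat) : odd N -> odd d -> coprime d N ->
  jacobi N d = (-1) ^+ (\sum_(i < N./2) (d * i.+1 %/ N))%N.
Proof.
move=> oddN oddd cop; rewrite /jacobi cop expr_sum.
have perm_sign : \prod_(i < N./2) (-1) ^+ abs_residue N (d * i.+1)
    = \prod_(i < N./2) (-1) ^+ i.+1 :> int.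
  exact: (big_abs_residue oddN cop _ (fun j => (-1) ^+ j)).
have sq1 : (\prod_(i < N./2) (-1) ^+ i.+1) * (\prod_(i < N./2) (-1) ^+ i.+1) = 1%R :> int.
  by rewrite -big_split big1 // => i _ /=; rewrite -expr2 sqrr_sign.
rewrite -[RHS]mulr1 -[X in _ = _ * X]sq1 -{1}perm_sign -2!big_split /=.
apply: eq_bigr => i _; rewrite -!exprD -[LHS]signr_odd -[RHS]signr_odd oddb !oddD.
have := congr1 odd (divn_eq (d * i.+1) N); rewrite oddM oddD oddM oddN oddd andbT /= => ->.
have /ltnW rN := ltn_pmod (d * i.+1) (odd_gt0 oddN).
rewrite /abs_residue; case: ifP => _; rewrite ?oddB // ?oddN;
  by case: (odd (_ %/ N)); case: (odd (_ %% N)).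
Qed.

Lemma sum_leq_divn (N m k : nat) : (0 < N)%N -> (m %/ N <= k)%N ->
  (\sum_(j < k) (N * j.+1 <= m) = m %/ N)%N.
Proof.
move=> N0 le_k; rewrite (eq_bigr (fun j : 'I_k => if (j < m %/ N)%N then 1 else 0)%N).
  by rewrite -big_mkcond -(big_ord_widen _ (fun=> 1%N)) // sum1_card card_ord.
by move=> j _; rewrite mulnC -leq_divRL //; case: ifP.
Qed.

(* Counts the lattice points of the rectangle on each side of its diagonal. *)
Lemma jacobi_reciprocity (N d : nat) : odd N -> odd d -> coprime d N ->
  jacobi N d * jacobi d N = (-1) ^+ (N./2 * d./2)%N.
Proof.
move=> oddN oddd cop; rewrite !jacobi_eisenstein // 1?coprime_sym // -exprD; congr (_ ^+ _).
have half_div (a b : nat) (i : 'I_a./2) : odd a -> odd b -> (b * i.+1 %/ a <= b./2)%N.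
  by move=> odda oddb; rewrite -ltnS ltn_divLR ?odd_gt0 //; have := ltn_ord i; nia.
rewrite (eq_bigr _ (fun i _ => esym (sum_leq_divn (odd_gt0 oddN) (half_div N d i oddN oddd)))).
rewrite (eq_bigr _ (fun i _ => esym (sum_leq_divn (odd_gt0 oddd) (half_div d N i oddd oddN)))).
rewrite [X in (_ + X)%N]exchange_big /= -big_split /= -[in RHS](card_ord N./2) -sum_nat_const.
apply: eq_bigr => i _; rewrite -big_split /= -[in RHS](card_ord d./2) -sum1_card.
apply: eq_bigr => j _; have := @Ndvdn_coprime_mul_half N oddN d cop i.
by case: ltngtP => // <-; rewrite dvdn_mulr.
Qed.

Lemma finField_sqr (F : finFieldType) (x : F) : odd #|F| -> x ^+ #|F|./2 = 1 ->
  exists y, x = y ^+ 2.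
Proof.
move=> oddF; set n := #|F|./2 => xn1.
have F1 : (1 < #|F|)%N := finNzRing_gt1 F; have n0 : (0 < n)%N by rewrite /n; lia.
have cardFE : #|F|.-1 = (2 * n)%N by rewrite /n; lia.
have unity (y : F) : y != 0 -> y ^+ (2 * n) = 1.
  by move=> y0; apply: (mulIf y0); rewrite -exprSr mul1r -cardFE prednK ?expf_card // ltnW.
have [||||z _ zP] := hasP (@has_prim_root _ (2 * n) (enum (predC1 (0 : F))) _ _ _ _).
- by rewrite muln_gt0.
- by apply/allP => y; rewrite mem_enum => y0; apply/unity_rootP/unity.
- exact: enum_uniq.
- by rewrite -cardE cardC1 cardFE.
have [|i xE] := prim_rootP zP (x := x); first by rewrite mulnC exprM xn1 expr1n.
have : (2 * n %| i * n)%N by rewrite (prim_order_dvd zP) exprM -xE xn1.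
rewrite dvdn_pmul2r // => /dvdnP[j iE].
by exists (z ^+ j); rewrite -exprM -iE.
Qed.

Section Legendre.
Variable p : nat.
Hypotheses (pr : prime p) (oddp : odd p).

Let natrFp_eq0 (k : nat) : (k%:R == 0 :> 'F_p) = (p %| k)%N.
Proof. by rewrite -(dvdn_pcharf (pchar_Fp pr)). Qed.

Lemma euler_criterion (d : nat) : coprime d p ->
  (d%:R : 'F_p) ^+ p./2 = (jacobi p d)%:~R.
Proof.
move=> cop; rewrite /jacobi cop; pose half_fact : 'F_p := \prod_(i < p./2) i.+1%:R.
have half_fact_neq0 : half_fact != 0.
  apply/prodf_neq0 => i _; rewrite natrFp_eq0; apply/negP => /dvdn_leq.
  by have := ltn_ord i; lia.
have -> : d%:R ^+ p./2 = \prod_(i < p./2) d%:R :> 'F_p by rewrite prodr_const card_ord.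
apply: (mulIf half_fact_neq0); rewrite {1}/half_fact -big_split /=.
rewrite /half_fact -(big_abs_residue oddp cop _ (fun j => j%:R : 'F_p)).
rewrite rmorph_prod -big_split /=; apply: eq_bigr => i _.
rewrite -natrM rmorphXn /= rmorphN1 -[LHS](Fp_nat_mod pr) /abs_residue.
have /ltnW rp := ltn_pmod (d * i.+1) (odd_gt0 oddp).
case: ifP => _; last by rewrite mul1r.
by rewrite natrB // pchar_Fp_0 // sub0r mulN1r opprK.
Qed.

Lemma jacobi_neg_residue (N : nat) : (N %% 4 = 3)%N -> coprime p N -> jacobi N p = 1 ->
  exists b, (p %| b ^ 2 + N)%N.
Proof.
move=> N3 cop j1; have oddN : odd N by lia.
have [||y yE] := @finField_sqr _ (- (N%:R) : 'F_p); rewrite ?card_Fp //.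
  have jE := jacobi_reciprocity oddN oddp cop; rewrite j1 mul1r in jE.
  rewrite exprNn euler_criterion 1?coprime_sym // jE rmorphXn /= rmorphN1.
  rewrite -exprD -mulSn -signr_odd oddM.
  by have -> : odd N./2.+1 = false by lia.
exists (val y); rewrite -natrFp_eq0 natrD natrX.
by rewrite (natr_Zp y) -yE addNr.
Qed.

End Legendre.

(** * Divisor sums of quadratic characters *)

Lemma sum_multiples (V : nmodType) (f : nat -> V) (n K : nat) : (0 < n)%N ->
  \sum_(1 <= m < K.+1 | (n %| m)%N) f m = \sum_(1 <= k < (K %/ n).+1) f (n * k)%N.
Proof.
move=> n0; elim: K => [|K IHK]; first by rewrite div0n !big_geq.
rewrite big_mkcond big_nat_recr //= -big_mkcond IHK divnS //.
case: ifP => dv; last by rewrite addr0.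
by rewrite add1n [RHS]big_nat_recr //= -{1}(divnK dv) divnS // dv mulnC.
Qed.

Definition divisor_sum (V : nmodType) (chi : nat -> V) (m : nat) : V :=
  \sum_(d <- divisors m) chi d.

Lemma divisor_sumE (V : nmodType) (chi : nat -> V) (m K : nat) : (0 < m <= K)%N ->
  divisor_sum chi m = \sum_(1 <= d < K.+1 | (d %| m)%N) chi d.
Proof.
move=> /andP[m0 mK]; rewrite /divisor_sum -[RHS]big_filter; apply: perm_big.
apply: uniq_perm; rewrite ?divisors_uniq ?filter_uniq ?iota_uniq // => d.
rewrite -dvdn_divisors // mem_filter mem_index_iota; case: (boolP (d %| m)%N) => //= dm.
by rewrite (dvdn_gt0 m0 dm) ltnS (leq_trans (dvdn_leq m0 dm)).
Qed.

Lemma perm_divisorsM (m n : nat) : (0 < m)%N -> (0 < n)%N -> coprime m n ->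
  perm_eq (divisors (m * n)) [seq (d * e)%N | d <- divisors m, e <- divisors n].
Proof.
move=> m0 n0 cop; have gcd_factor d e : (d %| m)%N -> (e %| n)%N -> gcdn (d * e) m = d.
  by move=> dm en; rewrite gcdnC Gauss_gcdl ?(coprime_dvdr en) //; exact/gcdn_idPr.
apply: uniq_perm; first exact: divisors_uniq.
  apply: allpairs_uniq; rewrite ?divisors_uniq // => u v.
  move=> /allpairsP[[d e] /= [dm en ->]] /allpairsP[[d' e'] /= [dm' en' ->]] /= deE.
  rewrite -!dvdn_divisors // in dm en dm' en'.
  have dE : d = d' by rewrite -(gcd_factor d e) // deE gcd_factor.
  by move/eqP: deE; rewrite dE eqn_pmul2l ?(dvdn_gt0 m0 dm') // => /eqP ->.
move=> x; rewrite -dvdn_divisors ?muln_gt0 ?m0 //.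
apply/idP/allpairsP => [xmn|[[d e] /= [dm en ->]]]; last first.
  by rewrite -!dvdn_divisors // in dm en *; exact: dvdn_mul.
have d0 : (0 < gcdn m x)%N by rewrite gcdn_gt0 m0.
have xE : x = (gcdn m x * (x %/ gcdn m x))%N by rewrite mulnC divnK ?dvdn_gcdr.
exists (gcdn m x, (x %/ gcdn m x)%N); split; rewrite //= -dvdn_divisors ?dvdn_gcdl //.
by rewrite -(dvdn_pmul2l d0) -xE muln_gcdl dvdn_gcd xmn dvdn_mulr.
Qed.

Lemma divisor_sumM (R : nzSemiRingType) (chi : nat -> R) (m n : nat) :
  {morph chi : d e / (d * e)%N >-> d * e} -> (0 < m)%N -> (0 < n)%N -> coprime m n ->
  divisor_sum chi (m * n) = divisor_sum chi m * divisor_sum chi n.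
Proof.
move=> chiM m0 n0 cop; rewrite /divisor_sum (perm_big _ (perm_divisorsM m0 n0 cop)) /=.
rewrite big_allpairs_dep mulr_suml; apply: eq_bigr => d _.
by rewrite mulr_sumr; apply: eq_bigr => e _; exact: chiM.
Qed.

Lemma perm_divisors_pfactor (p e : nat) : prime p ->
  perm_eq (divisors (p ^ e)) [seq (p ^ j)%N | j <- iota 0 e.+1].
Proof.
move=> pr; have p1 := prime_gt1 pr.
apply: uniq_perm; rewrite ?divisors_uniq ?map_inj_uniq ?iota_uniq //.
  by move=> i j /eqP; rewrite eqn_exp2l // => /eqP.
move=> d; rewrite -dvdn_divisors ?expn_gt0 ?prime_gt0 //.
apply/(dvdn_pfactor _ _ pr)/mapP => -[j je ->]; exists j; rewrite // ?mem_iota //.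
by rewrite mem_iota in je.
Qed.

Lemma divisor_sum_pfactor (R : nzSemiRingType) (chi : nat -> R) (p e : nat) :
  {morph chi : d e / (d * e)%N >-> d * e} -> chi 1%N = 1 -> prime p ->
  divisor_sum chi (p ^ e) = \sum_(j < e.+1) chi p ^+ j.
Proof.
move=> chiM chi1 pr; rewrite /divisor_sum (perm_big _ (perm_divisors_pfactor e pr)).
rewrite big_map -[iota 0 _]/(index_iota 0 e.+1) big_mkord; apply: eq_bigr => -[j _] _ /=.
by elim: j => [|j IHj]; rewrite ?expn0 ?chi1 // expnS chiM IHj exprS.
Qed.

Lemma coprime_prod_primes (p : nat) (s : seq nat) (e : nat -> nat) :
  prime p -> all prime s -> p \notin s -> coprime p (\prod_(q <- s) q ^ e q).
Proof.
move=> pr prs ps; rewrite big_seq; elim/big_rec: _ => [|q x qs copx]; first exact: coprimen1.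
rewrite coprimeMr copx andbT coprimeXr // prime_coprime // dvdn_prime2 //.
  by apply: contraNneq ps => ->.
exact: (allP prs).
Qed.

Lemma prod_primes_logn (m : nat) : (0 < m)%N -> m = (\prod_(p <- primes m) p ^ logn p m)%N.
Proof. by move=> m0; rewrite {1}(prod_prime_decomp m0) prime_decompE big_map. Qed.

Lemma divisor_sum_prod (R : comNzRingType) (chi : nat -> R) (m : nat) :
  {morph chi : d e / (d * e)%N >-> d * e} -> chi 1%N = 1 -> (0 < m)%N ->
  divisor_sum chi m = \prod_(p <- primes m) \sum_(j < (logn p m).+1) chi p ^+ j.
Proof.
move=> chiM chi1 m0; rewrite {1}(prod_primes_logn m0).
have : all prime (primes m) by apply/allP => p; rewrite mem_primes => /and3P[].
elim: (primes m) (primes_uniq m) => [_ _|p s IHs /= /andP[ps us] /andP[pr prs]].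
  by rewrite !big_nil /divisor_sum big_cons big_nil addr0.
rewrite !big_cons; have tail_gt0 : (0 < \prod_(q <- s) q ^ logn q m)%N.
  by rewrite big_seq prodn_cond_gt0 // => q /(allP prs)/prime_gt0 q0; rewrite expn_gt0 q0.
have cop : coprime (p ^ logn p m) (\prod_(q <- s) q ^ logn q m).
  exact/coprimeXl/coprime_prod_primes.
by rewrite divisor_sumM // ?expn_gt0 ?prime_gt0 // divisor_sum_pfactor // IHs.
Qed.

Lemma sum_sign_pow (R : pzRingType) (e : nat) : \sum_(j < e.+1) (-1) ^+ j = (~~ odd e)%:R :> R.
Proof.
elim: e => [|e IHe]; first by rewrite big_ord1.
by rewrite big_ord_recr /= IHe -signr_odd /=; case: (odd e); rewrite ?add0r ?subrr.
Qed.

Record quadratic_character (R : numDomainType) (M : nat) (chi : nat -> R) : Prop := {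
  qchar_period_gt0 : (0 < M)%N;
  qchar1 : chi 1%N = 1;
  qcharD : forall d, chi (d + M)%N = chi d;
  qcharM : {morph chi : d e / (d * e)%N >-> d * e};
  qchar_val : forall d, [|| chi d == 0, chi d == 1 | chi d == -1];
  qchar_coprime : forall d, ~~ coprime d M -> chi d = 0;
  qchar_sum0 : \sum_(d < M) chi d = 0 }.

Section QuadraticCharacter.
Variables (R : realDomainType) (M : nat) (chi : nat -> R).
Hypothesis charchi : quadratic_character M chi.

Lemma qchar_norm_le1 d : `|chi d| <= 1.
Proof. by case/or3P: (qchar_val charchi d) => /eqP ->; rewrite ?normrN ?normr0 ?normr1. Qed.

Lemma qchar_mod m n : m = n %[mod M] -> chi m = chi n.
Proof.
have periodic k i : chi (k * M + i)%N = chi i.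
  elim: k => [|k IHk]; first by rewrite mul0n.
  by rewrite mulSn -addnA addnC (qcharD charchi).
by move=> mn; rewrite (divn_eq m M) (divn_eq n M) !periodic mn.
Qed.

Lemma qchar_sum_bound K : `|\sum_(d < K) chi d.+1| <= M%:R.
Proof.
have shift n : \sum_(d < n) chi d.+1 + chi 0%N = \sum_(d < n) chi d + chi n.
  elim: n => [|n IHn]; first by rewrite !big_ord0.
  by rewrite !big_ord_recr /= addrAC IHn.
have sum_shift0 : \sum_(d < M) chi d.+1 = 0.
  apply: (addIr (chi 0%N)); rewrite shift (qchar_sum0 charchi).
  by rewrite (@qchar_mod M 0) // modnn mod0n.
elim/ltn_ind: K => K IHK; have [ltKM|leMK] := ltnP K M.
  rewrite (le_trans (ler_norm_sum _ _ _)) // (@le_trans _ _ (\sum_(d < K) 1)) //.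
    by apply: ler_sum => d _; exact: qchar_norm_le1.
  by rewrite sumr_const card_ord ler_nat ltnW.
rewrite -(subnKC leMK) big_split_ord /= sum_shift0 add0r.
rewrite (eq_bigr (fun i : 'I__ => chi i.+1)) => [|i _].
  by apply: IHK; have := qchar_period_gt0 charchi; lia.
by rewrite -addnS addnC (qcharD charchi).
Qed.

Lemma qchar_geom_sum_ge0 p e : 0 <= \sum_(j < e.+1) chi p ^+ j.
Proof.
case/or3P: (qchar_val charchi p) => /eqP ->; rewrite ?sum_sign_pow ?ler0n //;
  by apply: sumr_ge0 => j _; exact: exprn_ge0.
Qed.

Lemma qchar_geom_sum_ge1 p e : ~~ odd e -> 1 <= \sum_(j < e.+1) chi p ^+ j.
Proof.
case/or3P: (qchar_val charchi p) => /eqP -> e_even; rewrite ?sum_sign_pow ?e_even //;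
  by rewrite big_ord_recl expr0 lerDl sumr_ge0 // => j _; exact: exprn_ge0.
Qed.

Lemma divisor_sum_ge0 m : (0 < m)%N -> 0 <= divisor_sum chi m.
Proof.
move=> m0; rewrite (divisor_sum_prod (qcharM charchi) (qchar1 charchi) m0).
by apply: prodr_ge0 => p _; exact: qchar_geom_sum_ge0.
Qed.

Lemma divisor_sum_sqr_ge1 k : (0 < k)%N -> 1 <= divisor_sum chi (k ^ 2).
Proof.
move=> k0; rewrite (divisor_sum_prod (qcharM charchi) (qchar1 charchi)) ?expn_gt0 ?k0 //.
elim/big_rec: _ => // p x _ x1; apply: mulr_ege1 x1.
by apply: qchar_geom_sum_ge1; rewrite lognX oddM.
Qed.

Lemma divisor_sum_neq0_odd_logn m p : (0 < m)%N -> chi m != 0 -> divisor_sum chi m != 0 ->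
  odd (logn p m) -> chi p = 1.
Proof.
move=> m0 chim fm odd_pm.
have p_primes : p \in primes m by rewrite -logn_gt0 odd_gt0.
have pm : (p %| m)%N by move: p_primes; rewrite mem_primes => /and3P[].
have chip : chi p != 0.
  by move: chim; rewrite -(divnK pm) (qcharM charchi) mulf_eq0 negb_or => /andP[].
case/or3P: (qchar_val charchi p) => /eqP // chipE; first by rewrite chipE eqxx in chip.
move: fm; rewrite (divisor_sum_prod (qcharM charchi) (qchar1 charchi) m0).
by rewrite (big_rem _ p_primes) /= chipE sum_sign_pow odd_pm mul0r eqxx.
Qed.

End QuadraticCharacter.

Lemma prod_odd_primes_sqr (m : nat) : (0 < m)%N ->
  exists g, m = ((\prod_(p <- primes m | odd (logn p m)) p) * g ^ 2)%N.
Proof.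
move=> m0; exists (\prod_(p <- primes m) p ^ (logn p m)./2)%N.
rewrite {1}(prod_primes_logn m0) [in RHS]big_mkcond.
rewrite (big_morph (expn^~ 2) (fun x y => expnMn x y 2) (exp1n 2)) -big_split.
apply: eq_bigr => p _ /=.
by rewrite -expnM muln2 -{1}(odd_double_half (logn p m)) expnD; case: odd.
Qed.

Lemma dvdn_sqrD_prod (N : nat) (s : seq nat) : uniq s -> all prime s ->
  (forall p, p \in s -> exists b, (p %| b ^ 2 + N)%N) ->
  exists b, (\prod_(p <- s) p %| b ^ 2 + N)%N.
Proof.
elim: s => [|p s IHs] /=; first by exists 0%N; rewrite big_nil dvd1n.
move=> /andP[ps us] /andP[pr prs] roots.
have [b pb] := roots p (mem_head p s).
have [|c sc] := IHs us prs; first by move=> q qs; apply: roots; rewrite inE qs orbT.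
have cop : coprime p (\prod_(q <- s) q) := @coprime_prod_primes p s (fun=> 1%N) pr prs ps.
exists (chinese p (\prod_(q <- s) q) b c).
have root_mod q x y : x = y %[mod q] -> (q %| y ^ 2 + N)%N -> (q %| x ^ 2 + N)%N.
  by move=> xy; rewrite /dvdn -modnDml -modnXm -xy modnXm modnDml.
rewrite big_cons Gauss_dvd // (root_mod _ _ b (chinese_modl cop b c)) //=.
exact: (root_mod _ _ c (chinese_modr cop b c)).
Qed.

(** * Nonvanishing of L(1, chi) *)

Lemma abel_summation_bound (R : numDomainType) (B : R) (c w : nat -> R) (K : nat) :
  (forall n, `|\sum_(i < n) c i| <= B) -> (forall i, w i.+1 <= w i) ->
  (forall i, 0 <= w i) -> `|\sum_(i < K) c i * w i| <= B * w 0%N.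
Proof.
move=> cB w_dec w0; have B0 : 0 <= B := le_trans (normr_ge0 _) (cB 0%N).
case: K => [|K]; first by rewrite big_ord0 normr0 mulr_ge0.
have -> : \sum_(i < K.+1) c i * w i = (\sum_(i < K.+1) c i) * w K
    + \sum_(i < K) (\sum_(j < i.+1) c j) * (w i - w i.+1).
  elim: K => [|K IHK]; first by rewrite big_ord0 !big_ord1 addr0.
  rewrite big_ord_recr IHK [\sum_(i < K.+2) _]big_ord_recr /=.
  by rewrite [\sum_(i < K.+1) _ * (_ - _)]big_ord_recr /=; ring.
have -> : B * w 0%N = B * w K + \sum_(i < K) B * (w i - w i.+1).
  rewrite -mulr_sumr -mulrDr; congr (_ * _).
  elim: K => [|K IHK]; first by rewrite big_ord0 addr0.
  by rewrite big_ord_recr /= IHK; ring.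
apply: le_trans (ler_normD _ _) _; rewrite normrM (ger0_norm (w0 K)).
apply: lerD; first by rewrite ler_wpM2r.
apply: le_trans (ler_norm_sum _ _ _) _; apply: ler_sum => i _.
by rewrite normrM (ger0_norm (_ : 0 <= w i - w i.+1)) ?subr_ge0 // ler_wpM2r ?subr_ge0.
Qed.

Lemma bernoulli_inequality (R : realDomainType) (x : R) (n : nat) : 0 <= x ->
  1 - n%:R * (1 - x) <= x ^+ n.
Proof.
move=> x0; elim: n => [|n IHn]; first by rewrite mul0r subr0 expr0.
have := ler_wpM2l x0 IHn; rewrite -exprS; apply: le_trans.
rewrite -subr_ge0 -natr1 (_ : _ - _ = n%:R * (1 - x) ^+ 2); last by ring.
by rewrite mulr_ge0 ?ler0n ?sqr_ge0.
Qed.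

Lemma bin2_expr_le1 (R : numDomainType) (x : R) (n : nat) : 0 <= x <= 1 ->
  'C(n, 2)%:R * (1 - x) ^+ 2 * x ^+ n <= 1.
Proof.
move=> /andP[x0 x1]; have [n2|n2] := ltnP n 2; first by rewrite bin_small // !mul0r.
have binom1 : \sum_(i < n.+1) x ^+ (n - i) * (1 - x) ^+ i *+ 'C(n, i) = 1.
  by rewrite -exprDn addrC subrK expr1n.
apply: (@le_trans _ _ (x ^+ (n - 2) * (1 - x) ^+ 2 *+ 'C(n, 2))).
  rewrite -[leLHS]mulrA mulr_natl lerMn2r mulrC orbC ler_wpM2r ?exprn_ge0 ?subr_ge0 //.
  by rewrite ler_wiXn2l // leq_subr.
rewrite -[leRHS]binom1 (bigD1 (Ordinal (n2 : (2 < n.+1)%N))) //= lerDl sumr_ge0 // => i _.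
by rewrite mulrn_wge0 // mulr_ge0 ?exprn_ge0 ?subr_ge0.
Qed.

Lemma natrM_expr_le_eventually (R : archiRealFieldType) (x eps : R) : 0 <= x < 1 -> 0 < eps ->
  exists K0, forall K, (K0 <= K)%N -> K%:R * x ^+ K <= eps.
Proof.
move=> /andP[x0 x1] eps0; pose h : R := (1 - x) ^+ 2.
have h0 : 0 < h by rewrite exprn_gt0 // subr_gt0.
exists (Num.truncn (2 / (eps * h))).+2 => -[//|K]; rewrite ltnS => leK.
have K_large : 2 <= eps * h * K%:R.
  rewrite [leRHS]mulrC -ler_pdivrMr ?(mulr_gt0 eps0 h0) //.
  by apply: le_trans (ltW (truncnS_gt _)) _; rewrite ler_nat.
have := @bin2_expr_le1 _ x K.+1; rewrite x0 ltW // -/h => /(_ isT) bin_le1.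
have binE : 2 * 'C(K.+1, 2)%:R = K.+1%:R * K%:R :> R by rewrite -!natrM -mul_bin_diag bin1.
have xK0 : 0 <= K.+1%:R * x ^+ K.+1 by rewrite mulr_ge0 ?exprn_ge0.
rewrite -(ler_pM2l (ltr0Sn R 1)) (le_trans (ler_wpM2r xK0 K_large)) //.
have -> : eps * h * K%:R * (K.+1%:R * x ^+ K.+1)
    = eps * h * (K.+1%:R * K%:R) * x ^+ K.+1 by ring.
rewrite -binE (_ : _ * _ = 2 * eps * ('C(K.+1, 2)%:R * h * x ^+ K.+1)); last by ring.
by rewrite ler_piMr // mulr_ge0 // ltW.
Qed.

Definition geom_sum (R : pzSemiRingType) (x : R) (n : nat) : R := \sum_(i < n) x ^+ i.

Lemma multiples_geom_sum (R : comPzRingType) (x : R) (n K : nat) : (0 < n)%N ->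
  (1 - x) * (\sum_(1 <= m < K.+1 | (n %| m)%N) x ^+ m) * geom_sum x n
  = x ^+ n - x ^+ (n * (K %/ n).+1).
Proof.
move=> n0; have geomE (y : R) k : (1 - y) * geom_sum y k = 1 - y ^+ k.
  by rewrite -opprB mulNr -subrX1 opprB.
rewrite sum_multiples // mulrAC geomE big_add1 /= big_mkord.
rewrite (eq_bigr (fun i : 'I_(K %/ n) => x ^+ n * (x ^+ n) ^+ i)) => [|i _].
  by rewrite -mulr_sumr mulrCA geomE mulrBr mulr1 -exprS -exprM.
by rewrite -exprS exprM.
Qed.

Section MonskyWeight.
Variables (R : realFieldType) (x : R).
Hypotheses (x0 : 0 <= x) (x1 : x <= 1).

Lemma geom_sum_ge1 n : 1 <= geom_sum x n.+1.
Proof.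
by rewrite /geom_sum big_ord_recl expr0 lerDl sumr_ge0 // => i _; exact: exprn_ge0.
Qed.

Lemma geom_sum_gt0 n : 0 < geom_sum x n.+1.
Proof. exact: lt_le_trans ltr01 (geom_sum_ge1 n). Qed.

Lemma expr_amgm (a b k : nat) : (a + b <= 2 * k)%N -> 2 * x ^+ k <= x ^+ a + x ^+ b.
Proof.
wlog ak : a b / (a <= k)%N.
  move=> wlog_le; case: (leqP a k) => ak abk; first exact: wlog_le.
  by rewrite addrC; apply: wlog_le; lia.
move=> abk; apply: (@le_trans _ _ (x ^+ a + x ^+ (2 * k - a))); last first.
  by rewrite lerD2l ler_wiXn2l //; lia.
have [j kE] : exists j, k = (a + j)%N by exists (k - a)%N; lia.
rewrite kE (_ : 2 * _ - a = a + (j + j))%N; last by lia.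
rewrite !exprD -subr_ge0 (_ : _ - _ = x ^+ a * (1 - x ^+ j) ^+ 2); last by ring.
by rewrite mulr_ge0 ?sqr_ge0 ?exprn_ge0.
Qed.

(* Pairs the terms of indices [(i, j)] and [(m - i, n - j)]. *)
Lemma geom_sum_mul_ge (m n k : nat) : (m + n <= 2 * k)%N ->
  m.+1%:R * n.+1%:R * x ^+ k <= geom_sum x m.+1 * geom_sum x n.+1.
Proof.
move=> mnk; rewrite -(ler_pM2l (ltr0Sn R 1)).
have -> : 2 * (m.+1%:R * n.+1%:R * x ^+ k) = \sum_(i < m.+1) \sum_(j < n.+1) 2 * x ^+ k.
  by rewrite !sumr_const !card_ord -[RHS]mulr_natl -[X in _ = _ * X]mulr_natl; ring.
have prodE : geom_sum x m.+1 * geom_sum x n.+1 = \sum_(i < m.+1) \sum_(j < n.+1) x ^+ (i + j).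
  rewrite mulr_suml; apply: eq_bigr => i _; rewrite mulr_sumr.
  by apply: eq_bigr => j _; rewrite exprD.
rewrite [leRHS]mulr_natl mulr2n prodE.
rewrite [X in _ <= _ + X](reindex_inj rev_ord_inj) -big_split; apply: ler_sum => i _ /=.
rewrite [X in _ <= _ + X](reindex_inj rev_ord_inj) -big_split; apply: ler_sum => j _ /=.
by apply: expr_amgm; have := ltn_ord i; have := ltn_ord j; lia.
Qed.

Definition monsky_weight n : R := n.+1%:R^-1 - x ^+ n.+1 / geom_sum x n.+1.

Lemma monsky_weight0 : monsky_weight 0 = 1 - x.
Proof. by rewrite /monsky_weight /geom_sum big_ord1 expr0 expr1 invr1 mulr1. Qed.

Lemma monsky_weight_ge0 n : 0 <= monsky_weight n.
Proof.
rewrite subr_ge0 ler_pdivrMr ?geom_sum_gt0 // mulrC ler_pdivlMr ?ltr0n // mulr_natr.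
have -> : x ^+ n.+1 *+ n.+1 = \sum_(i < n.+1) x ^+ n.+1 by rewrite sumr_const card_ord.
by apply: ler_sum => i _; rewrite ler_wiXn2l // ltnW.
Qed.

Lemma monsky_weight_dec n : monsky_weight n.+1 <= monsky_weight n.
Proof.
have sS : geom_sum x n.+2 - x * geom_sum x n.+1 = 1.
  rewrite {1}/geom_sum big_ord_recl expr0 mulr_sumr -addrA -sumrB big1 ?addr0 // => i _.
  by rewrite -exprS subrr.
have gap_ge0 := @geom_sum_mul_ge n n.+1 n.+1 ltac:(lia).
rewrite -subr_ge0 in gap_ge0; rewrite -subr_ge0 /monsky_weight [x ^+ n.+2]exprS.
move: (geom_sum x n.+1) (geom_sum x n.+2) (geom_sum_gt0 n) (geom_sum_gt0 n.+1) sS gap_ge0.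
move=> s t s_gt0 t_gt0 stE gap_ge0.
rewrite (_ : _ - _ = (s * t - n.+1%:R * n.+2%:R * x ^+ n.+1) / (n.+1%:R * n.+2%:R * (s * t))).
  by rewrite divr_ge0 ?mulr_ge0 ?ler0n // ltW.
have natS : n.+2%:R - n.+1%:R = 1 :> R by rewrite -natr1 addrAC subrr add0r.
move: (n.+1%:R : R) (n.+2%:R : R) (ltr0Sn R n) (ltr0Sn R n.+1) natS (x ^+ n.+1).
move=> a b a0 b0 abE p.
transitivity ((b - a) / (a * b) - p * (t - x * s) / (s * t)).
  by field; rewrite !gt_eqF.
by rewrite stE abE; field; rewrite !gt_eqF.
Qed.

End MonskyWeight.

Lemma lambert_partial_sum (R : realFieldType) (chi : nat -> R) (x : R) (K : nat) : 0 <= x <= 1 ->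
  (1 - x) * \sum_(1 <= m < K.+1) divisor_sum chi m * x ^+ m
  = \sum_(i < K) chi i.+1 *
      ((x ^+ i.+1 - x ^+ (i.+1 * (K %/ i.+1).+1)) / geom_sum x i.+1).
Proof.
move=> /andP[x0 x1]; transitivity ((1 - x) * \sum_(1 <= n < K.+1)
    chi n * \sum_(1 <= m < K.+1 | (n %| m)%N) x ^+ m).
  congr (_ * _); under [RHS]eq_bigr => n _ do rewrite mulr_sumr big_mkcond.
  rewrite [RHS]exchange_big; apply: eq_big_nat => m mK.
  by rewrite (@divisor_sumE _ _ m K) // -big_mkcond mulr_suml; exact: eq_bigr.
rewrite big_add1 /= big_mkord mulr_sumr; apply: eq_bigr => i _.
by rewrite -multiples_geom_sum // mulrCA mulfK // gt_eqF // geom_sum_gt0.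
Qed.

Lemma sum_sqr_le_sum (R : numDomainType) (F : nat -> R) (J K : nat) :
  (forall m, (0 < m)%N -> 0 <= F m) ->
  (J ^ 2 <= K)%N -> \sum_(1 <= k < J.+1) F (k ^ 2)%N <= \sum_(1 <= m < K.+1) F m.
Proof.
move=> F0; have mono a b : (0 < a <= b)%N -> \sum_(1 <= m < a) F m <= \sum_(1 <= m < b) F m.
  move=> /andP[a0 ab]; rewrite [leRHS](big_cat_nat a0 ab) lerDl big_nat sumr_ge0 //= => m.
  by case/andP=> /(leq_trans a0) m0 _; exact: F0.
move=> JK; apply: le_trans (mono (J ^ 2).+1 K.+1 JK); elim: {JK}J => [|J IHJ].
  by rewrite big_geq // big_geq.
rewrite big_nat_recr //= [leRHS]big_nat_recr ?expn_gt0 //= lerD2r.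
by rewrite (le_trans IHJ) // mono //= ltn_exp2r.
Qed.

Lemma exists_expr_ge_half (R : realFieldType) (n : nat) :
  exists2 x : R, 0 <= x < 1 & 1 / 2 <= x ^+ n.
Proof.
pose h : R := (2 * n.+1)%:R^-1; have h0 : 0 < h by rewrite invr_gt0 ltr0n.
have nhE : n.+1%:R * h = 1 / 2 by rewrite /h natrM invfM mulrCA divff ?mulr1 ?pnatr_eq0 // mul1r.
have hn : n%:R * h <= 1 / 2 by rewrite -nhE ler_pM2r // ler_nat.
have h1 : h <= 1 by rewrite invf_le1 ?ler1n ?ltr0n.
exists (1 - h); first by apply/andP; split; lra.
have := @bernoulli_inequality _ (1 - h) n; rewrite subr_ge0 => /(_ h1).
by apply: le_trans; lra.
Qed.

Section LowerBound.
Variables (R : archiRealFieldType) (M : nat) (chi : nat -> R).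
Hypothesis charchi : quadratic_character M chi.

(* Monsky's argument: the partial sums of the Lambert series of [chi] differ from
   those of [L(1, chi)] by [\sum_n chi n * monsky_weight n], whose weights
   decrease, up to the error of truncation. *)
Lemma monsky_inequality (x : R) (K : nat) : 0 <= x <= 1 ->
  (1 - x) * \sum_(1 <= m < K.+1) divisor_sum chi m * x ^+ m
  <= \sum_(i < K) chi i.+1 / i.+1%:R + M%:R * (1 - x) + K%:R * x ^+ K.
Proof.
move=> x01; have /andP[x0 x1] := x01; rewrite (lambert_partial_sum _ _ x01).
pose tail i := x ^+ (i.+1 * (K %/ i.+1).+1) / geom_sum x i.+1.
have -> : \sum_(i < K) chi i.+1 *
      ((x ^+ i.+1 - x ^+ (i.+1 * (K %/ i.+1).+1)) / geom_sum x i.+1)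
    = \sum_(i < K) chi i.+1 / i.+1%:R - \sum_(i < K) chi i.+1 * monsky_weight x i
      - \sum_(i < K) chi i.+1 * tail i.
  rewrite -!sumrB; apply: eq_bigr => i _; rewrite /monsky_weight /tail mulrBl; ring.
have weighted_le : `|\sum_(i < K) chi i.+1 * monsky_weight x i| <= M%:R * (1 - x).
  rewrite -monsky_weight0; apply: (abel_summation_bound (c := fun i => chi i.+1)).
  - exact: qchar_sum_bound charchi.
  - by move=> i; exact: monsky_weight_dec.
  - by move=> i; exact: monsky_weight_ge0.
have tail_le : `|\sum_(i < K) chi i.+1 * tail i| <= K%:R * x ^+ K.
  apply: le_trans (ler_norm_sum _ _ _) _.
  have -> : K%:R * x ^+ K = \sum_(i < K) x ^+ K by rewrite sumr_const card_ord mulr_natl.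
  apply: ler_sum => i _.
  have s0 := geom_sum_gt0 x0 i.
  rewrite normrM -[leRHS]mul1r ler_pM ?(qchar_norm_le1 charchi) //.
  rewrite ger0_norm; last by rewrite divr_ge0 ?exprn_ge0 // ltW.
  rewrite ler_pdivrMr // (@le_trans _ _ (x ^+ K)) ?ler_peMr ?exprn_ge0 ?geom_sum_ge1 //.
  by apply: ler_wiXn2l => //; rewrite mulnC ltnW // ltn_ceil.
by move: weighted_le tail_le; rewrite !ler_norml; lra.
Qed.

Lemma sum_divisor_sum_ge (x : R) (J K : nat) : 0 <= x <= 1 -> 1 / 2 <= x ^+ (J ^ 2) ->
  (J ^ 2 <= K)%N -> J%:R / 2 <= \sum_(1 <= m < K.+1) divisor_sum chi m * x ^+ m.
Proof.
move=> /andP[x0 x1] half_le JK.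
have F0 m : (0 < m)%N -> 0 <= divisor_sum chi m * x ^+ m.
  by move=> m0; rewrite mulr_ge0 ?exprn_ge0 ?(divisor_sum_ge0 charchi).
apply: le_trans (sum_sqr_le_sum F0 JK).
have -> : J%:R / 2 = \sum_(i < J) 1 / 2 :> R by rewrite sumr_const card_ord mul1r mulr_natl.
rewrite big_add1 /= big_mkord; apply: ler_sum => k _; apply: le_trans half_le _.
rewrite (@le_trans _ _ (x ^+ (k.+1 ^ 2))) //.
  by rewrite ler_wiXn2l // ?ltW // leq_exp2r.
by rewrite ler_peMl ?exprn_ge0 // (divisor_sum_sqr_ge1 charchi).
Qed.

Lemma L1_partial_sums_lower_bound : exists2 delta : R, 0 < delta &
  exists K0, forall K, (K0 <= K)%N -> delta <= \sum_(i < K) chi i.+1 / i.+1%:R.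
Proof.
pose J := (2 * (M + 2))%N; have [x /andP[x0 x1] half_le] := exists_expr_ge_half R (J ^ 2).
have x01 : 0 <= x <= 1 by rewrite x0 ltW.
have h0 : 0 < 1 - x by rewrite subr_gt0.
have [K1 tail_le] := natrM_expr_le_eventually (introT andP (conj x0 x1)) h0.
exists (1 - x) => //; exists (maxn (J ^ 2) K1) => K; rewrite geq_max => /andP[KJ /tail_le tailK].
have := sum_divisor_sum_ge x01 half_le KJ.
have -> : J%:R / 2 = M%:R + 2 :> R by rewrite natrM natrD mulrAC divff ?mul1r.
move=> /(ler_wpM2l (ltW h0)); have := monsky_inequality K x01.
by lra.
Qed.

End LowerBound.

(** * Divisor sums in residue classes *)

Lemma sum_nat_leq_divn (V : nmodType) (f : nat -> V) (d Y : nat) : (0 < d)%N ->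
  \sum_(1 <= k < (Y %/ d).+1) f k = \sum_(1 <= k < Y.+1 | (d * k <= Y)%N) f k.
Proof.
move=> d0; rewrite (@big_nat_widen _ _ _ _ _ Y.+1) ?ltnS ?leq_div //.
by apply: eq_bigl => k /=; rewrite ltnS leq_divRL // mulnC.
Qed.

Lemma sum_over_divisor_pairs (V : nmodType) (F : nat -> nat -> V) (Y : nat) :
  \sum_(1 <= m < Y.+1) divisor_sum (fun d => F d (m %/ d)%N) m
  = \sum_(1 <= d < Y.+1) \sum_(1 <= k < (Y %/ d).+1) F d k.
Proof.
transitivity (\sum_(1 <= m < Y.+1) \sum_(1 <= d < Y.+1 | (d %| m)%N) F d (m %/ d)%N).
  by apply: eq_big_nat => m mY; rewrite (@divisor_sumE _ _ m Y).
rewrite (exchange_big_dep predT) //=; apply: eq_big_nat => d /andP[d0 _].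
by rewrite sum_multiples //; apply: eq_bigr => k _; rewrite mulKn.
Qed.

Lemma hyperbola_method (V : zmodType) (F : nat -> nat -> V) (D : nat) :
  (forall d k, F d k = F k d) ->
  \sum_(1 <= m < (D ^ 2).+1) divisor_sum (fun d => F d (m %/ d)%N) m
  = (\sum_(1 <= d < D.+1) \sum_(1 <= k < (D ^ 2 %/ d).+1) F d k) *+ 2
    - \sum_(1 <= d < D.+1) \sum_(1 <= k < D.+1) F d k.
Proof.
move=> symF; rewrite sum_over_divisor_pairs; set Y := (D ^ 2)%N.
have leDY : (D <= Y)%N by rewrite /Y; nia.
pose G d k := if (d * k <= Y)%N then F d k else 0.
have symG d k : G d k = G k d by rewrite /G mulnC symF.
have rowE a b : (0 < a)%N -> \sum_(a <= d < b) \sum_(1 <= k < (Y %/ d).+1) F d k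
    = \sum_(a <= d < b) \sum_(1 <= k < Y.+1) G d k.
  move=> a0; apply: eq_big_nat => d /andP[/(leq_trans a0) d0 _].
  by rewrite sum_nat_leq_divn // big_mkcond.
have squareE : \sum_(1 <= d < D.+1) \sum_(1 <= k < D.+1) F d k
    = \sum_(1 <= d < D.+1) \sum_(1 <= k < D.+1) G d k.
  apply: eq_big_nat => d /andP[_ dD]; apply: eq_big_nat => k /andP[_ kD].
  by rewrite /G ifT // /Y expnS expn1 leq_mul.
have far_zero : \sum_(D.+1 <= d < Y.+1) \sum_(D.+1 <= k < Y.+1) G d k = 0.
  rewrite big_nat big1 // => d /andP[Dd _]; rewrite big_nat big1 // => k /andP[Dk _].
  by rewrite /G ifF //; apply/negbTE; rewrite -ltnNge /Y; nia.
have splitk a b : \sum_(a <= d < b) \sum_(1 <= k < Y.+1) G d k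
    = \sum_(a <= d < b) \sum_(1 <= k < D.+1) G d k
      + \sum_(a <= d < b) \sum_(D.+1 <= k < Y.+1) G d k.
  by rewrite -big_split; apply: eq_bigr => d _; rewrite /= -big_cat_nat.
have swap : \sum_(D.+1 <= d < Y.+1) \sum_(1 <= k < D.+1) G d k
    = \sum_(1 <= d < D.+1) \sum_(D.+1 <= k < Y.+1) G d k.
  by rewrite exchange_big; apply: eq_bigr => d _; apply: eq_bigr => k _; exact: symG.
rewrite (@big_cat_nat _ _ _ D.+1) //= !rowE // squareE.
rewrite (splitk D.+1) far_zero addr0 swap splitk.
move: (\sum_(1 <= d < D.+1) \sum_(1 <= k < D.+1) G d k) => near.
move: (\sum_(1 <= d < D.+1) \sum_(D.+1 <= k < Y.+1) G d k) => far.
by rewrite mulr2n [near + far]addrC -[RHS]addrA addrK.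
Qed.

Lemma count_dvdn_shift (M e Y : nat) : (0 < M)%N ->
  (\sum_(1 <= k < Y.+1) (M %| k + e) + e %/ M = (Y + e) %/ M)%N.
Proof.
move=> M0; elim: Y => [|Y IHY]; first by rewrite big_geq.
by rewrite big_nat_recr //= addnAC IHY addnC addSn divnS.
Qed.

Lemma eqmod_coprime_shift (M a d : nat) : (0 < M)%N -> coprime d M ->
  exists e, forall k, (d * k == a %[mod M])%N = (M %| k + e)%N.
Proof.
move=> M0 cop; pose d' := (chinese d M 0 1 %/ d)%N.
have dd' : (d * d' = 1 %[mod M])%N.
  by rewrite mulnC divnK ?(chinese_modr cop) // /dvdn (chinese_modl cop) mod0n.
exists (M.-1 * (d' * a))%N => k.
have -> : (M %| k + M.-1 * (d' * a))%N = (k == d' * a %[mod M])%N.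
  rewrite /dvdn -[X in _ == X](mod0n M) -(eqn_modDr (d' * a)) add0n -addnA.
  by rewrite addnC -mulSnr prednK // mulnC modnMDl.
apply/eqP/eqP => eq_mod.
  by rewrite -[k]mul1n -modnMml -dd' modnMml -mulnA mulnCA -modnMmr eq_mod modnMmr.
by rewrite -modnMmr eq_mod modnMmr mulnA -modnMml dd' modnMml mul1n.
Qed.

Lemma count_eqmod_bounds (M a d Y : nat) : (0 < M)%N -> coprime d M ->
  let c := (\sum_(1 <= k < Y.+1) (d * k == a %[mod M]))%N in
  (M * c <= Y + M)%N /\ (Y <= M * c + M)%N.
Proof.
move=> M0 cop c; have [e dkE] := eqmod_coprime_shift a M0 cop.
have := count_dvdn_shift e Y M0; have -> : (\sum_(1 <= k < Y.+1) (M %| k + e))%N = c.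
  by apply: eq_bigr => k _; rewrite dkE.
have := divn_eq (Y + e) M; have := divn_eq e M.
have := ltn_pmod (Y + e) M0; have := ltn_pmod e M0.
by move: c ((Y + e) %% M)%N (e %% M)%N ((Y + e) %/ M)%N (e %/ M)%N; nia.
Qed.

Section ResidueClass.
Variables (R : archiRealFieldType) (M : nat) (chi : nat -> R) (a : nat).
Hypotheses (charchi : quadratic_character M chi) (chia : chi a = 1).

Let M_gt0 : 0 < M%:R :> R. Proof. by rewrite ltr0n (qchar_period_gt0 charchi). Qed.

Definition class_term (d k : nat) : R := if (d * k == a %[mod M])%N then chi d else 0.

Lemma class_term_sym d k : class_term d k = class_term k d.
Proof.
rewrite /class_term mulnC; case: ifP => // /eqP /(qchar_mod charchi).
rewrite chia (qcharM charchi) => kd1.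
by case/or3P: (qchar_val charchi d) kd1 => /eqP ->; case/or3P: (qchar_val charchi k) => /eqP ->;
  rewrite ?mul0r ?mulr0 ?mul1r ?mulr1 // => /esym/eqP; rewrite ?oner_eq0.
Qed.

Lemma class_term_sum_bound d Z :
  `|\sum_(1 <= k < Z.+1) class_term d k - chi d * (Z%:R / M%:R)| <= 1.
Proof.
pose c := (\sum_(1 <= k < Z.+1) (d * k == a %[mod M]))%N.
have -> : \sum_(1 <= k < Z.+1) class_term d k = chi d * c%:R.
  rewrite /c natr_sum mulr_sumr; apply: eq_bigr => k _; rewrite /class_term.
  by case: ifP; rewrite ?mulr1 ?mulr0.
rewrite -mulrBr normrM.
have [cop|/(qchar_coprime charchi) ->] := boolP (coprime d M); last by rewrite normr0 mul0r.
rewrite -[leRHS]mul1r ler_pM ?(qchar_norm_le1 charchi) //.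
have [] := count_eqmod_bounds a Z (qchar_period_gt0 charchi) cop; rewrite -/c.
rewrite -!(ler_nat R) !natrD !natrM [M%:R * _]mulrC => le_c le_Z.
rewrite ler_norml lerBlDr lerBrDr -(ler_pM2r M_gt0) -[X in _ && X](ler_pM2r M_gt0).
by rewrite !mulrDl mulfVK ?gt_eqF // mulN1r mul1r; apply/andP; split; lra.
Qed.

Lemma hyperbola_rows_lower_bound D :
  (D ^ 2)%:R / M%:R * (\sum_(i < D) chi i.+1 / i.+1%:R) - 2 * D%:R
  <= \sum_(1 <= d < D.+1) \sum_(1 <= k < (D ^ 2 %/ d).+1) class_term d k.
Proof.
rewrite lerBlDr -lerBlDl big_add1 big_mkord /= mulr_sumr -sumrB.
have -> : 2 * D%:R = \sum_(i < D) 2 :> R by rewrite sumr_const card_ord mulr_natr.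
apply: ler_sum => i _; have := class_term_sum_bound i.+1 (D ^ 2 %/ i.+1).
move: (\sum_(_ <= _ < _) _) => S errS.
pose q : R := (D ^ 2)%:R / i.+1%:R - (D ^ 2 %/ i.+1)%:R.
have i0 : 0 < i.+1%:R :> R by rewrite ltr0n.
have q0 : 0 <= q by rewrite subr_ge0 ler_pdivlMr // -natrM ler_nat leq_divM.
have q1 : q <= 1.
  by rewrite lerBlDr ler_pdivrMr // nat1r -natrM ler_nat ltnW // ltn_ceil.
have -> : (D ^ 2)%:R / M%:R * (chi i.+1 / i.+1%:R)
    = chi i.+1 * ((D ^ 2 %/ i.+1)%:R / M%:R) + chi i.+1 * (q / M%:R).
  by rewrite /q; field; rewrite !gt_eqF // nat1r.
have qM : `|chi i.+1 * (q / M%:R)| <= 1.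
  rewrite normrM -[leRHS]mulr1 ler_pM ?(qchar_norm_le1 charchi) //.
  rewrite (ger0_norm (divr_ge0 q0 (ltW M_gt0))) ler_pdivrMr // mul1r.
  by rewrite (le_trans q1) // ler1n (qchar_period_gt0 charchi).
move: errS qM; rewrite !ler_norml.
by move: (chi _ * _) (chi _ * _) => u v; lra.
Qed.

Lemma hyperbola_square_upper_bound D :
  \sum_(1 <= d < D.+1) \sum_(1 <= k < D.+1) class_term d k <= 2 * D%:R.
Proof.
have sum_chi_le : \sum_(i < D) chi i.+1 * (D%:R / M%:R) <= D%:R.
  rewrite -mulr_suml mulrA ler_pdivrMr // mulrC ler_wpM2l ?ler0n //.
  exact: le_trans (ler_norm _) (qchar_sum_bound charchi _).
have sum1 : \sum_(i < D) (1 : R) = D%:R by rewrite sumr_const card_ord.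
rewrite big_add1 big_mkord /=.
apply: (@le_trans _ _ (\sum_(i < D) (chi i.+1 * (D%:R / M%:R) + 1))); last first.
  by rewrite big_split /= sum1; move: sum_chi_le; lra.
by apply: ler_sum => i _; have := class_term_sum_bound i.+1 D; rewrite ler_norml; lra.
Qed.

Lemma divisor_sum_class_term m : (0 < m)%N ->
  divisor_sum (fun d => class_term d (m %/ d)) m
  = if (m == a %[mod M])%N then divisor_sum chi m else 0.
Proof.
move=> m0; have termE d : d \in divisors m ->
    class_term d (m %/ d) = if (m == a %[mod M])%N then chi d else 0.
  by rewrite -dvdn_divisors // /class_term mulnC => dm; rewrite divnK.
by rewrite /divisor_sum (eq_big_seq _ termE); case: ifP => // _; rewrite big1.
Qed.

Lemma sum_divisor_sum_class_gt0 :
  exists D, 0 < \sum_(1 <= m < (D ^ 2).+1 | (m == a %[mod M])%N) divisor_sum chi m.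
Proof.
have [delta delta0 [K0 leL1]] := L1_partial_sums_lower_bound charchi.
pose D := (maxn K0 (Num.truncn (3 * M%:R / delta))).+1.
have D0 : 0 < D%:R :> R by rewrite ltr0n.
have {}leL1 : delta <= \sum_(i < D) chi i.+1 / i.+1%:R by apply: leL1; rewrite leqW // leq_maxl.
have D_large : 3 * M%:R < D%:R * delta.
  rewrite -ltr_pdivrMr //; apply: lt_le_trans (truncnS_gt _) _.
  by rewrite ler_nat ltnS leq_maxr.
exists D; have -> : \sum_(1 <= m < (D ^ 2).+1 | (m == a %[mod M])%N) divisor_sum chi m
    = \sum_(1 <= m < (D ^ 2).+1) divisor_sum (fun d => class_term d (m %/ d)) m.
  by rewrite big_mkcond; apply: eq_big_nat => m /andP[m0 _]; rewrite divisor_sum_class_term.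
rewrite (hyperbola_method D class_term_sym).
move: (hyperbola_rows_lower_bound D) (hyperbola_square_upper_bound D) leL1.
move: (\sum_(i < D) _) (\sum_(_ <= _ < _) _) (\sum_(_ <= _ < _) _) => L rows square.
move=> rows_ge square_le leL1; have : 3 * D%:R < (D ^ 2)%:R / M%:R * L.
  rewrite mulrAC ltr_pdivlMr // natrX expr2 -[ltRHS]mulrA [ltLHS]mulrAC [ltLHS]mulrC ltr_pM2l //.
  by rewrite (lt_le_trans D_large) // ler_wpM2l // ltW.
by rewrite mulr2n; lra.
Qed.

Lemma exists_divisor_sum_neq0 : exists m : nat,
  [/\ (0 < m)%N, (m = a %[mod M])%N & divisor_sum chi m != 0].
Proof.
have [D sum_gt0] := sum_divisor_sum_class_gt0.
have [/hasP[m]|/hasPn none] := boolP (has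
    (fun m => (m == a %[mod M])%N && (divisor_sum chi m != 0)) (index_iota 1 (D ^ 2).+1)).
  by rewrite mem_index_iota => /andP[m0 _] /andP[/eqP ma fm]; exists m.
move: sum_gt0; rewrite big_seq_cond big1 ?ltxx // => m /andP[mi ma].
by have := none m mi; rewrite ma negbK => /eqP.
Qed.

End ResidueClass.

(** * Sums of three and four squares *)

Definition odd_jacobi (R : pzRingType) (N d : nat) : R := if odd d then (jacobi N d)%:~R else 0.

Lemma odd_jacobiN (R : pzRingType) (N d : nat) : (N %% 4 = 3)%N -> (d <= 2 * N)%N ->
  odd_jacobi R N (2 * N - d) = - odd_jacobi R N d.
Proof.
move=> N3 dN; have oddN : odd N by lia.
rewrite /odd_jacobi oddB // oddM /=; case: (odd d); last by rewrite oppr0.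
have /ltnW dm := ltn_pmod d (odd_gt0 oddN).
rewrite -[in RHS]jacobi_mod -rmorphN /= -jacobiN //; congr (_%:~R).
rewrite -jacobi_mod -[RHS]jacobi_mod; congr jacobi; apply/eqP.
by rewrite -(eqn_modDr d) subnK // -[X in _ == X]modnDmr subnK // modnMl modnn.
Qed.

Lemma sum_odd_jacobi (R : numDomainType) (N : nat) : (N %% 4 = 3)%N ->
  \sum_(d < 2 * N) odd_jacobi R N d = 0.
Proof.
move=> N3; have -> : (2 * N = (2 * N).-1.+1)%N by lia.
rewrite big_ord_recl [X in X + _](_ : _ = 0) // add0r.
set S := \sum_(i < _) _; suff /eqP : S = - S by rewrite -addr_eq0 -mulr2n mulrn_eq0 => /eqP.
rewrite {1}/S (reindex_inj rev_ord_inj) /S -sumrN /=; apply: eq_bigr => i _.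
rewrite /bump /= -odd_jacobiN //; last by have := ltn_ord i; lia.
by congr odd_jacobi; have := ltn_ord i; lia.
Qed.

Lemma odd_jacobi_character (R : numDomainType) (N : nat) : (N %% 4 = 3)%N ->
  quadratic_character (2 * N) (odd_jacobi R N).
Proof.
move=> N3; have oddN : odd N by lia.
split.
- by lia.
- by rewrite /odd_jacobi jacobi1.
- move=> d; rewrite /odd_jacobi oddD oddM addbF.
  by rewrite -[jacobi N (d + _)]jacobi_mod addnC modnMDl jacobi_mod.
- move=> d e; rewrite /odd_jacobi oddM jacobiM //.
  by case: (odd d); case: (odd e); rewrite /= ?mulr0 ?mul0r // intrM.
- move=> d; rewrite /odd_jacobi; case: (odd d); last by rewrite eqxx.
  by case/or3P: (jacobi_val N d) => /eqP ->; rewrite ?mulrN1z ?eqxx ?orbT.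
- move=> d; rewrite /odd_jacobi coprimeMr coprimen2 /jacobi.
  by case: (odd d) => //= /negPf ->.
- exact: sum_odd_jacobi.
Qed.

Lemma jacobi_half (N : nat) : (N %% 8 = 3)%N -> jacobi N N./2 = 1.
Proof.
move=> N3; have oddN : odd N by lia.
have : jacobi N (2 * N./2) = -1.
  have -> : (2 * N./2 = N - 1)%N by lia.
  by rewrite jacobiN ?jacobi1 //; lia.
by rewrite jacobiM // jacobi2 // mulN1r => /oppr_inj.
Qed.

Lemma odd_jacobi_prime_residue (R : numDomainType) (N p : nat) : (N %% 4 = 3)%N -> prime p ->
  odd_jacobi R N p = 1 -> exists b, (p %| b ^ 2 + N)%N.
Proof.
move=> N3 pr; rewrite /odd_jacobi; case: ifP => [oddp|_ /esym/eqP]; last by rewrite oner_eq0.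
rewrite -[1]/(1%:~R) => /eqP; rewrite eqr_int => /eqP jp; apply: jacobi_neg_residue => //.
by move: jp; rewrite /jacobi; case: ifP.
Qed.

Lemma exists_residue_data (N : nat) : (N %% 8 = 3)%N -> exists P s t b w : nat,
  [/\ (0 < P)%N, (N * s = P * t ^ 2 + 1)%N & (b ^ 2 + N = w * P)%N].
Proof.
move=> N3; have [oddN N4] : odd N /\ (N %% 4 = 3)%N by lia.
have charchi := odd_jacobi_character rat N4.
have chih : odd_jacobi rat N N./2 = 1 by rewrite /odd_jacobi jacobi_half // ifT //; lia.
have [m [m0 mh fm]] := exists_divisor_sum_neq0 charchi chih.
have chim : odd_jacobi rat N m != 0 by rewrite (qchar_mod charchi mh) chih oner_eq0.
have [g mE] := prod_odd_primes_sqr m0; pose s := [seq p <- primes m | odd (logn p m)].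
have mhE : (m = m %/ (2 * N) * (2 * N) + N./2)%N.
  by rewrite [LHS](divn_eq m (2 * N)) mh [(N./2 %% _)%N]modn_small //; lia.
have chi1 p : p \in s -> odd_jacobi rat N p = 1.
  by rewrite mem_filter => /andP[/(divisor_sum_neq0_odd_logn charchi m0 chim fm)].
have prs : all prime (2%N :: s).
  by apply/allP => p; rewrite inE mem_filter mem_primes => /orP[/eqP ->|/and4P[]].
have uniqs : uniq (2%N :: s).
  rewrite /= filter_uniq ?primes_uniq // andbT; apply/negP => /chi1 /esym/eqP.
  by rewrite oner_eq0.
have [p|b /dvdnP[w bE]] := @dvdn_sqrD_prod N _ uniqs prs.
  rewrite inE => /orP[/eqP ->|ps]; first by exists 1%N; rewrite dvdn2 oddD oddN.
  have pr : prime p by apply: (allP prs); rewrite inE ps orbT.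
  exact: odd_jacobi_prime_residue (chi1 p ps).
rewrite big_cons in bE.
exists (2 * \prod_(p <- s) p)%N, (m %/ (2 * N) * 4 + 1)%N, g, b, w; split=> //.
  by rewrite muln_gt0 big_filter; move: m0; rewrite {1}mE muln_gt0 => /andP[].
rewrite -mulnA big_filter -mE; move: (m %/ (2 * N))%N mhE => k ->; clear -oddN; lia.
Qed.

Theorem three_squares_mod8 (N : nat) : (N %% 8 = 3)%N ->
  exists x y z : int, N%:Z = x ^+ 2 + y ^+ 2 + z ^+ 2.
Proof.
move=> N3; have [P [s [t [b [w [P0 NsE bE]]]]]] := exists_residue_data N3.
move: NsE bE => /(congr1 Posz) + /(congr1 Posz); rewrite !(PoszD, PoszM) => NsE bE.
apply: (@three_squares_of_residues N P s t b (w%:Z * s%:Z - t%:Z ^+ 2)).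
- by rewrite ltz_nat; lia.
- by rewrite ltz_nat.
- by rewrite NsE.
- by lia.
Qed.

Lemma sqrz_mod4 (x : int) : (x ^+ 2 %% 4)%Z = (x %% 2)%Z.
Proof.
have xE := divz_eq x 2; move: (x %/ 2)%Z xE => k xE.
have [x0|x1] : (x %% 2)%Z = 0 \/ (x %% 2)%Z = 1 by lia.
  have -> : x ^+ 2 = k ^+ 2 * 4 by rewrite xE x0; ring.
  by rewrite modzMl x0.
have -> : x ^+ 2 = (k ^+ 2 + k) * 4 + 1 by rewrite xE x1; ring.
by rewrite modzMDl x1.
Qed.

Lemma three_squares_odd (x y z : int) : ((x ^+ 2 + y ^+ 2 + z ^+ 2) %% 4)%Z = 3 ->
  [/\ (x %% 2)%Z = 1, (y %% 2)%Z = 1 & (z %% 2)%Z = 1].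
Proof.
have := sqrz_mod4 x; have := sqrz_mod4 y; have := sqrz_mod4 z.
by move: (x ^+ 2) (y ^+ 2) (z ^+ 2) => a b c; split; lia.
Qed.

Lemma sqr_add3_le (R : realDomainType) (x y z : R) :
  (x + y + z) ^+ 2 <= 3 * (x ^+ 2 + y ^+ 2 + z ^+ 2).
Proof.
rewrite -subr_ge0 (_ : _ - _ = (x - y) ^+ 2 + (y - z) ^+ 2 + (z - x) ^+ 2); last by ring.
by rewrite !addr_ge0 ?sqr_ge0.
Qed.

Lemma exists_quarter (n : nat) (w : int) : w ^+ 2 <= n%:Z ^+ 2 -> ((n%:Z + w) %% 4)%Z = 0 ->
  exists a : nat, 4 * a%:Z = n%:Z + w.
Proof.
move=> le_wn nw4; exists (absz ((n%:Z + w) %/ 4)%Z).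
have : `|w| <= n%:Z by rewrite -(@ler_pXn2r _ 2) ?nnegrE // real_normK ?num_real.
by rewrite ler_norml => /andP[]; lia.
Qed.

Lemma sqrn_odd_mod8 (n : nat) : odd n -> (n ^ 2 %% 8 = 1)%N.
Proof.
move=> oddn; have nE : n = (2 * n./2 + 1)%N by lia.
have : (2 %| n./2 * n./2.+1)%N by rewrite dvdn2 oddM /=; case: (odd _).
by move=> /dvdnP[k]; rewrite nE expnS expn1; nia.
Qed.

Lemma four_squares_of_three (n S : nat) (x y z : int) : (3 * S <= n ^ 2)%N ->
  x ^+ 2 + y ^+ 2 + z ^+ 2 = 4 * S%:Z - n%:Z ^+ 2 ->
  [/\ (x %% 2)%Z = 1, (y %% 2)%Z = 1 & (z %% 2)%Z = 1] ->
  ((n%:Z + (x + y + z)) %% 4)%Z = 0 -> exists a b c d : nat,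
  (a + b + c + d = n)%N /\ (a ^ 2 + b ^ 2 + c ^ 2 + d ^ 2 = S)%N.
Proof.
move=> S3 xyzE [xo yo zo] div4.
have le_n (u v w : int) : u ^+ 2 + v ^+ 2 + w ^+ 2 = 4 * S%:Z - n%:Z ^+ 2 ->
    (u + v + w) ^+ 2 <= n%:Z ^+ 2.
  move=> uvwE; apply: le_trans (sqr_add3_le _ _ _) _; rewrite uvwE.
  by move: S3; rewrite -lez_nat PoszM -mulnn PoszM -expr2; lia.
have [a aE] := exists_quarter (le_n x y z xyzE) div4.
have [||b bE] := @exists_quarter n (x - y - z).
- by apply: le_n; rewrite !sqrrN.
- by clear -xo yo zo div4; lia.
have [||c cE] := @exists_quarter n (- x + y - z).
- by apply: le_n; rewrite !sqrrN.
- by clear -xo yo zo div4; lia.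
have [||d dE] := @exists_quarter n (- x - y + z).
- by apply: le_n; rewrite !sqrrN.
- by clear -xo yo zo div4; lia.
exists a, b, c, d; split; first by clear -aE bE cE dE; lia.
have : 16 * (a%:Z ^+ 2 + b%:Z ^+ 2 + c%:Z ^+ 2 + d%:Z ^+ 2) = 16 * S%:Z.
  transitivity ((4 * a%:Z) ^+ 2 + (4 * b%:Z) ^+ 2 + (4 * c%:Z) ^+ 2 + (4 * d%:Z) ^+ 2).
    by ring.
  rewrite aE bE cE dE.
  transitivity (4 * (n%:Z ^+ 2 + (x ^+ 2 + y ^+ 2 + z ^+ 2))); first by ring.
  by rewrite xyzE; ring.
by rewrite !expr2 !expnS !expn0; clear; lia.
Qed.

Theorem cauchy_four_squares (n S : nat) : odd n -> odd S -> (n ^ 2 < 4 * S)%N ->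
  (3 * S <= n ^ 2)%N -> exists a b c d : nat,
  (a + b + c + d = n)%N /\ (a ^ 2 + b ^ 2 + c ^ 2 + d ^ 2 = S)%N.
Proof.
move=> oddn oddS n4 S3; have n8 := sqrn_odd_mod8 oddn.
have [|x [y [z xyz]]] := @three_squares_mod8 (4 * S - n ^ 2); first by lia.
have xyzE : x ^+ 2 + y ^+ 2 + z ^+ 2 = 4 * S%:Z - n%:Z ^+ 2.
  by rewrite -xyz -subzn 1?ltnW // PoszM expnS expn1 PoszM expr2.
have [xo yo zo] : [/\ (x %% 2)%Z = 1, (y %% 2)%Z = 1 & (z %% 2)%Z = 1].
  by apply: three_squares_odd; rewrite -xyz modz_nat; lia.
have [div4|div4] : ((n%:Z + (x + y + z)) %% 4)%Z = 0 \/ ((n%:Z + (x + y + - z)) %% 4)%Z = 0.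
- by clear -oddn xo yo zo; lia.
- exact: four_squares_of_three xyzE _ div4.
- by apply: four_squares_of_three div4; rewrite ?sqrrN //; split=> //; clear -zo; lia.
Qed.

(** * Edge counts of disjoint unions of cliques *)

Section CliqueEdgeCounts.
Local Open Scope nat_scope.

Lemma double_bin2 (k : nat) : 2 * 'C(k, 2) + k = k ^ 2.
Proof. by elim: k => // k IHk; rewrite binS bin1 -[k.+1 in RHS]addn1 sqrnD -IHk; lia. Qed.

Lemma cliqueEdgeCountsP (n r m : nat) : cliqueEdgeCounts n r m <->
  exists2 k : 'I_r -> nat, \sum_(i < r) k i = n & \sum_(i < r) k i ^ 2 = 2 * m + n.
Proof.
have sum_sqrE (k : 'I_r -> nat) :
    \sum_(i < r) k i ^ 2 = 2 * (\sum_(i < r) 'C(k i, 2)) + \sum_(i < r) k i.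
  by rewrite big_distrr -big_split; apply: eq_bigr => i _; rewrite /= double_bin2.
split=> -[k kn mE]; exists k => //; first by rewrite sum_sqrE kn mE.
by move: mE; rewrite sum_sqrE kn; lia.
Qed.

Lemma leq_sqr_sum (r : nat) (k : 'I_r -> nat) :
  (\sum_(i < r) k i) ^ 2 <= r * \sum_(i < r) k i ^ 2.
Proof.
rewrite -(leq_pmul2l (isT : 0 < 2)).
have -> : 2 * (\sum_(i < r) k i) ^ 2 = \sum_(i < r) \sum_(j < r) 2 * (k i * k j).
  rewrite expnS expn1 big_distrlr big_distrr; apply: eq_bigr => i _.
  by rewrite big_distrr.
have -> : 2 * (r * \sum_(i < r) k i ^ 2) = \sum_(i < r) \sum_(j < r) (k i ^ 2 + k j ^ 2).
  under [RHS]eq_bigr => i _ do rewrite big_split /= sum_nat_const card_ord.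
  by rewrite big_split /= sum_nat_const card_ord -big_distrr /= mul2n addnn.
by apply: leq_sum => i _; apply: leq_sum => j _; exact: nat_Cauchy.
Qed.

Lemma leq_sum_sqr (r : nat) (k : 'I_r -> nat) :
  \sum_(i < r) k i ^ 2 <= (\sum_(i < r) k i) ^ 2.
Proof.
rewrite expnS expn1 big_distrl; apply: leq_sum => i _ /=.
by rewrite expnS expn1 leq_mul2l (bigD1 i) //= leq_addr orbT.
Qed.

Lemma cliqueEdgeCounts_bounds (n r m : nat) : cliqueEdgeCounts n r m ->
  n ^ 2 <= r * (2 * m + n) /\ 2 * m + n <= n ^ 2.
Proof.
by move=> /cliqueEdgeCountsP[k <- <-]; split; [exact: leq_sqr_sum | exact: leq_sum_sqr].
Qed.

Lemma cliqueEdgeCounts_seq (n m : nat) (s : seq nat) :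
  \sum_(x <- s) x = n -> \sum_(x <- s) x ^ 2 = 2 * m + n -> cliqueEdgeCounts n (size s) m.
Proof.
move=> sn s2; apply/cliqueEdgeCountsP; exists (fun i => nth 0 s i).
  by rewrite -sn (big_nth 0) big_mkord.
by rewrite -s2 (big_nth 0) big_mkord.
Qed.

(* [q] cliques of [y] vertices, one of [T], and four more supplied by Cauchy's lemma. *)
Lemma cliqueEdgeCounts_cauchy (n m q y T : nat) : n = q * y + T + (4 * y + 1) ->
  q * y ^ 2 + T ^ 2 + 4 * y ^ 2 + 2 * y + 1 <= 2 * m + n ->
  3 * (2 * m + n) <= 3 * (q * y ^ 2 + T ^ 2) + (4 * y + 1) ^ 2 ->
  cliqueEdgeCounts n (q + 5) m.
Proof.
move=> nE lo up; have [S SE] : exists S, 2 * m + n = S + q * y ^ 2 + T ^ 2.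
  by exists (2 * m + n - q * y ^ 2 - T ^ 2); lia.
have [||||a [b [c [d [abcd abcd2]]]]] := @cauchy_four_squares (4 * y + 1) S.
- by rewrite addn1 /= oddM.
- have := congr1 odd SE; rewrite nE !oddD !oddM ?oddX /=.
  by case: (odd S); case: (odd m); case: (odd q); case: (odd y); case: (odd T).
- by rewrite SE in lo; rewrite sqrnD; lia.
- by rewrite SE in up; lia.
have -> : q + 5 = size (nseq q y ++ [:: T; a; b; c; d]) by rewrite size_cat size_nseq.
apply: cliqueEdgeCounts_seq; rewrite big_cat /= big_nseq !big_cons big_nil iter_addn_0.
  by rewrite [RHS]nE -abcd; clear; lia.
by rewrite SE -abcd2; clear; lia.
Qed.

Lemma exists_balanced_size (n p S : nat) : 0 < n ->
  n ^ 2 + p.+1 ^ 3 + p.+1 <= p.+1 * S ->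
  exists y, (p * y <= n - 1) && (p * y ^ 2 + (n - 1 - p * y) ^ 2 + 2 * y + 1 <= S).
Proof.
move=> n0 lo; exists ((n - 1) %/ p.+1).
have := divn_eq (n - 1) p.+1; have := ltn_pmod (n - 1) (ltn0Sn p).
move: ((n - 1) %/ p.+1) ((n - 1) %% p.+1) => y w wp nE.
have {}nE : n = p * y + y + w + 1 by move: nE; rewrite mulnS mulnC; clear -n0; lia.
have -> : n - 1 - p * y = y + w by rewrite nE; clear; lia.
apply/andP; split; first by rewrite nE; clear; lia.
rewrite -(leq_pmul2l (ltn0Sn p)); apply: leq_trans lo.
have : p.+1 * w ^ 2 <= p.+1 ^ 3 by rewrite (expnS _ 2) leq_mul2l leq_exp2r // ltnW.
by rewrite nE; clear; lia.
Qed.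

(* The least [y] leaving the four Cauchy cliques enough edges leaves them not too
   many, as one step of [y] changes the count by only [O(n)]. *)
Lemma exists_cauchy_size (n p S z : nat) : n ^ 2 + p.+1 ^ 3 + p.+1 <= p.+1 * S ->
  S < (n - 1 - p * z) ^ 2 -> 6 * p * n + 3 * p ^ 2 <= 4 * z ^ 2 ->
  exists y T, [/\ n = p * y + T + 1, p * y ^ 2 + T ^ 2 + 2 * y + 1 <= S
    & 3 * S <= 3 * (p * y ^ 2 + T ^ 2) + 4 * y ^ 2].
Proof.
move=> lo up zP; have n0 : 0 < n by case: n up {lo zP}.
have [y /andP[yn yS] ymin] := ex_minnP (exists_balanced_size n0 lo).
pose T := n - 1 - p * y; exists y, T; rewrite -/T in yS.
have lt_zy : z < y.
  rewrite ltnNge; apply/negP => le_yz; have : (n - 1 - p * z) ^ 2 <= T ^ 2.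
    by rewrite leq_exp2r // leq_sub2l // leq_mul2l le_yz orbT.
  by move: yS up; clear; lia.
have lt_S : S < p * y.-1 ^ 2 + (T + p) ^ 2 + 2 * y.-1 + 1.
  have : ~~ ((p * y.-1 <= n - 1) &&
      (p * y.-1 ^ 2 + (n - 1 - p * y.-1) ^ 2 + 2 * y.-1 + 1 <= S)).
    by apply/negP => /ymin; clear -lt_zy; lia.
  have -> : n - 1 - p * y.-1 = T + p.
    rewrite /T; move: yn lt_zy; case: (y) => // y'; rewrite /= mulnS; clear; lia.
  have -> : p * y.-1 <= n - 1 by apply: leq_trans yn; rewrite leq_mul2l leq_pred orbT.
  by rewrite -ltnNge.
split=> //; first by rewrite /T; clear -n0 yn; lia.
have pT : p * T <= p * n by rewrite leq_mul2l /T; clear; lia.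
have z2 : z ^ 2 <= y.-1 ^ 2 by rewrite leq_exp2r // -ltnS prednK // (leq_ltn_trans _ lt_zy).
have T2 : (T + p) ^ 2 = T ^ 2 + 2 * (p * T) + p ^ 2 by rewrite sqrnD; clear; lia.
have y2 : y ^ 2 = y.-1 ^ 2 + 2 * y.-1 + 1.
  by rewrite -{1}(prednK (leq_ltn_trans (leq0n z) lt_zy)) -addn1 sqrnD; clear; lia.
have py2 : p * y ^ 2 = p * y.-1 ^ 2 + 2 * (p * y.-1) + p by rewrite y2; clear; lia.
move: lt_S zP pT z2; rewrite T2 -mulnA py2 y2; clear.
move: (p * y.-1 ^ 2) (p * T) (p * n) (p ^ 2) (T ^ 2) (p * y.-1) (z ^ 2) (y.-1 ^ 2).
by lia.
Qed.

End CliqueEdgeCounts.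

Lemma cliqueEdgeCounts_interval (n r m z : nat) : (5 <= r)%N ->
  (n ^ 2 + r ^ 3 + r <= r * (2 * m + n))%N ->
  (2 * m + n < (n - 1 - r.-1 * z) ^ 2)%N ->
  (6 * r.-1 * n + 3 * r.-1 ^ 2 <= 4 * z ^ 2)%N ->
  cliqueEdgeCounts n r m.
Proof.
move=> r5; have -> : r = (r - 5 + 4).+1 by lia.
move: (r - 5)%N => q lo up zP; have [y [T [nE yS Sy]]] := exists_cauchy_size lo up zP.
have qy2 : ((q + 4) * y ^ 2 = q * y ^ 2 + 4 * y ^ 2)%N by rewrite mulnDl.
have -> : (q + 4).+1 = (q + 5)%N by rewrite -addnS.
apply: (@cliqueEdgeCounts_cauchy n m q y T).
- by rewrite nE; lia.
- by move: yS; rewrite qy2; lia.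
- by move: Sy; rewrite qy2 sqrnD; lia.
Qed.

Section IntegerPoints.
Variables (R : archiRealFieldType) (A : {fset nat}) (x y : R).

Lemma card_fset_nat_le : 0 <= y -> x <= y -> {in A, forall m, x <= m%:R <= y} ->
  #|` A|%:R <= y - x + 2.
Proof.
move=> y0 xy bounds; pose s := index_iota (Num.truncn x) (Num.truncn y).+1.
have cardsE : #|` seq_fset tt s| = ((Num.truncn y).+1 - Num.truncn x)%N.
  by rewrite size_seq_fset undup_id ?iota_uniq // size_iota.
have : (#|` A| <= #|` seq_fset tt s|)%N.
  apply/fsubset_leq_card/fsubsetP => m mA; have /andP[xm my] := bounds m mA.
  by rewrite seq_fsetE mem_index_iota ltnS truncn_ge_nat // my truncn_le_nat
    (le_lt_trans xm) // ltr_nat.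
rewrite cardsE -(ler_nat R) natrB ?leqW ?le_truncn // -natr1 => /le_trans; apply.
have := truncnS_gt x; have := truncn_le y; rewrite y0 -natr1; lra.
Qed.

Lemma card_fset_nat_ge : 0 <= x -> (forall m : nat, x <= m%:R <= y -> m \in A) ->
  y - x - 2 <= #|` A|%:R.
Proof.
move=> x0 inA; pose s := index_iota (Num.truncn x).+1 (Num.truncn y).
have cardsE : #|` seq_fset tt s| = (Num.truncn y - (Num.truncn x).+1)%N.
  by rewrite size_seq_fset undup_id ?iota_uniq // size_iota.
have : (#|` seq_fset tt s| <= #|` A|)%N.
  apply/fsubset_leq_card/fsubsetP => m; rewrite seq_fsetE mem_index_iota.
  rewrite truncn_lt_nat // truncn_gt_nat => /andP[/ltW xm my]; apply: inA.
  by rewrite xm (le_trans _ my) // ler_nat.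
rewrite cardsE leq_subLR -(ler_nat R) natrD -natr1.
have := truncnS_gt y; have := truncn_le x; rewrite x0 -natr1; lra.
Qed.

End IntegerPoints.

Lemma mem_fset_cliqueEdgeCounts (n r m : nat) :
  m \in fset_set (cliqueEdgeCounts n r) <-> cliqueEdgeCounts n r m.
Proof.
by rewrite in_fset_set; [rewrite inE | exact: finite_cliqueEdgeCounts].
Qed.

Lemma leq_sqr_subn (n u : nat) : (n ^ 2 <= (n - u) ^ 2 + 2 * (u * n))%N.
Proof.
have [nu|/ltnW un] := leqP n u.
  by apply: leq_trans (leq_addl _ _); rewrite -mulnn mulnCA leq_mul // leq_pmull.
by rewrite -{1}(subnK un) sqrnD; nia.
Qed.

Lemma numCliqueEdgeCounts_upper (R : archiRealFieldType) (n r : nat) : (0 < r)%N ->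
  (numCliqueEdgeCounts n r)%:R <= n%:R ^+ 2 / 2 - n%:R ^+ 2 / (2 * r%:R) + 2 :> R.
Proof.
move=> r0; have r0' : 0 < r%:R :> R by rewrite ltr0n.
pose x : R := (n%:R ^+ 2 / r%:R - n%:R) / 2; pose y : R := (n%:R ^+ 2 - n%:R) / 2.
have -> : n%:R ^+ 2 / 2 - n%:R ^+ 2 / (2 * r%:R) = y - x.
  by rewrite /x /y; field; rewrite gt_eqF.
apply: card_fset_nat_le => [||m /mem_fset_cliqueEdgeCounts/cliqueEdgeCounts_bounds[lo up]].
- by rewrite divr_ge0 // subr_ge0 -natrX ler_nat -mulnn; nia.
- rewrite ler_pM2r ?invr_gt0 // lerD2r ler_pdivrMr // ler_peMr ?sqr_ge0 //.
  by rewrite ler1n.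
move: lo up; rewrite -!(ler_nat R) !(natrM, natrD, natrX) => lo up.
have {}lo : n%:R ^+ 2 / r%:R <= 2 * m%:R + n%:R :> R by rewrite ler_pdivrMr // mulrC.
by apply/andP; split; rewrite /x /y; lra.
Qed.

Lemma numCliqueEdgeCounts_lower (R : archiRealFieldType) (n r z : nat) : (5 <= r)%N ->
  (6 * r.-1 * n + 3 * r.-1 ^ 2 <= 4 * z ^ 2)%N ->
  n%:R ^+ 2 / 2 - n%:R ^+ 2 / (2 * r%:R)
    - ((2 + r.-1 * z) * n + r ^ 2 + 4)%:R <= (numCliqueEdgeCounts n r)%:R :> R.
Proof.
move=> r5 zP; have r0 : 0 < r%:R :> R by rewrite ltr0n; lia.
pose u := (1 + r.-1 * z)%N.
pose x : R := n%:R ^+ 2 / (2 * r%:R) + (r ^ 2 + 1)%:R.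
pose y : R := n%:R ^+ 2 / 2 - n%:R / 2 - (u * n)%:R - 1.
apply: (@le_trans _ _ (y - x - 2)).
  rewrite /x /y /u !(natrM, natrD, natrX); have := ler0n R n.
  by move: (n%:R ^+ 2 / (2 * r%:R)) => q; lra.
apply: card_fset_nat_ge => [|m /andP[xm my]].
  by rewrite addr_ge0 ?divr_ge0 ?mulr_ge0 ?sqr_ge0 // ltW.
have lo : (n ^ 2 + 2 * r * (r ^ 2 + 1) <= 2 * r * m)%N.
  rewrite addnC -(ler_nat R) !(natrM, natrD, natrX) -lerBrDl -mulrBr [leRHS]mulrC.
  by rewrite -ler_pdivrMr ?mulr_gt0 // lerBrDr; move: xm; rewrite /x natrD natrX.
have up : (2 * m + n + 2 * (u * n) + 2 <= n ^ 2)%N.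
  by move: my; rewrite -(ler_nat R) /y !(natrM, natrD, natrX); lra.
apply/mem_fset_cliqueEdgeCounts/(cliqueEdgeCounts_interval r5 _ _ zP).
  by move: lo; rewrite (expnS r 2); lia.
by have := leq_sqr_subn n u; rewrite /u subnDA -/u; lia.
Qed.

Lemma sqrtr_nat_ge1 (R : rcfType) (n : nat) : (0 < n)%N -> 1 <= Num.sqrt n%:R :> R.
Proof. by move=> n0; rewrite -[leLHS]sqrtr1; apply: ler_wsqrtr; rewrite ler1n. Qed.

Lemma exists_sqr_ge (R : realType) (n : nat) : (0 < n)%N ->
  exists s : nat, (n <= s ^ 2)%N /\ s%:R <= 2 * Num.sqrt n%:R :> R.
Proof.
move=> n0; have sqrt_ge0 : 0 <= Num.sqrt n%:R :> R := sqrtr_ge0 _.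
exists (Num.truncn (Num.sqrt n%:R : R)).+1; split.
  rewrite -(ler_nat R) natrX -[leLHS]sqr_sqrtr ?ler0n // lerXn2r ?nnegrE ?ler0n //.
  exact/ltW/truncnS_gt.
have := truncn_le (Num.sqrt n%:R : R); rewrite sqrt_ge0 -natr1.
by have := sqrtr_nat_ge1 R n0; lra.
Qed.

Lemma numCliqueEdgeCounts_error (R : realType) (n r : nat) : (5 <= r)%N -> (0 < n)%N ->
  `|(numCliqueEdgeCounts n r)%:R - (n%:R ^+ 2 / 2 - n%:R ^+ 2 / (2 * r%:R))|
  <= (5 * r ^ 2 + 6)%:R * (n%:R * Num.sqrt n%:R) :> R.
Proof.
move=> r5 n0; have [s [ns s_le]] := exists_sqr_ge R n0.
have rsn : (r.-1 * n <= r ^ 2 * s ^ 2)%N by rewrite leq_mul // -mulnn; nia.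
have rs : (r.-1 ^ 2 <= r ^ 2 * s ^ 2)%N.
  by rewrite -[leqLHS]muln1 leq_mul ?leq_sqr ?leq_pred // (leq_trans n0).
pose e := ((2 + r.-1 * (2 * (r * s))) * n + r ^ 2 + 4)%N.
have lo : n%:R ^+ 2 / 2 - n%:R ^+ 2 / (2 * r%:R) - e%:R <= (numCliqueEdgeCounts n r)%:R :> R.
  by apply: numCliqueEdgeCounts_lower => //; rewrite !expnMn; lia.
have up := numCliqueEdgeCounts_upper R n (ltn_trans (isT : (0 < 4)%N) r5).
pose w : R := n%:R * Num.sqrt n%:R.
have n_le : n%:R <= w by rewrite ler_peMr ?ler0n ?sqrtr_nat_ge1.
have r2_le : (r ^ 2 + 4)%:R <= (r ^ 2 + 4)%:R * w.
  by rewrite ler_peMr ?ler0n // (le_trans _ n_le) // ler1n.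
have rsn_le : (2 * r ^ 2 * n)%:R * s%:R <= 4 * r%:R ^+ 2 * w.
  have -> : 4 * r%:R ^+ 2 * w = (2 * r ^ 2 * n)%:R * (2 * Num.sqrt n%:R).
    by rewrite /w !(natrX, natrM); ring.
  by rewrite ler_wpM2l ?ler0n.
have err : e%:R <= (5 * r ^ 2 + 6)%:R * w.
  have : e%:R <= (2 * r ^ 2 * n)%:R * s%:R + 2 * n%:R + (r ^ 2 + 4)%:R :> R.
    rewrite -!(natrM, natrD) ler_nat /e addnA leq_add2r leq_add2r mulnDl addnC leq_add2r.
    have := leq_mul (leq_pred r) (leqnn (2 * (r * s) * n)); lia.
  by move: n_le r2_le rsn_le; rewrite !(natrD, natrM, natrX); lra.
have e2 : 2 <= e%:R :> R by rewrite ler_nat (leq_trans _ (leq_addl _ 4)).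
move: lo up err e2; rewrite ler_norml -/w.
move: (_ / 2 - _) (e%:R : R) (_ * w) => main error bound.
by lra.
Qed.

Theorem theorem4p2 (R : realType) (r : nat) (hr : (5 <= r)%N) :
  (fun n : nat => (numCliqueEdgeCounts n r)%:R : R)
    = (fun n : nat => n%:R ^+ 2 / 2 - n%:R ^+ 2 / (2 * r%:R) : R)
      +o_\oo (fun n : nat => n%:R ^+ 2 : R).
Proof.
apply/eqaddoP => eps eps0; pose C : R := (5 * r ^ 2 + 6)%:R.
near=> n; have n0 : (0 < n)%N by near: n; exact: nbhs_infty_gt.
apply: le_trans (numCliqueEdgeCounts_error R hr n0) _.
have sqrt_large : C <= eps * Num.sqrt n%:R.
  rewrite mulrC -ler_pdivrMr // -ler_sqr ?nnegrE ?divr_ge0 ?sqrtr_ge0 ?ler0n ?(ltW eps0) //.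
  rewrite sqr_sqrtr ?ler0n //; near: n; exact: nbhs_infty_ger.
have sqrE : n%:R ^+ 2 = Num.sqrt n%:R * (n%:R * Num.sqrt n%:R) :> R.
  by rewrite mulrCA -expr2 sqr_sqrtr ?ler0n // expr2.
rewrite ger0_norm ?exprn_ge0 ?ler0n // sqrE [leRHS]mulrA.
by rewrite ler_wpM2r ?mulr_ge0 ?sqrtr_ge0 ?ler0n.
Unshelve. all: by end_near. Qed.
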